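(* Let $M\subset B(H)$ be a von Neumann algebra admitting a cyclic vector, and let $M'$ be its commutant. Let $y_1,\ldots,y_n\in M'$ be such that for all $x_1,\ldots,x_n\in M$, \[\Big\|\sum_{i=1}^n x_iy_i\Big\|\le \max\Big\{\Big\|\sum_i x_i^*x_i\Big\|^{1/2},\Big\|\sum_i x_ix_i^*\Big\|^{1/2}\Big\}.\] Then there is a decomposition $y_i=a_i+b_i$ ($i=1,\ldots,n$) with $a_i,b_i\in M'$ such that $\|\sum_i a_ia_i^*\|\le 1$ and $\|\sum_i b_i^*b_i\|\le 1$. *)

(* Defs.v *)
From HB Require Import structures.
From mathcomp Require Import all_boot all_order all_algebra.
From mathcomp Require Import complex.
From mathcomp Require Import boolp classical_sets reals.
Set Implicit Arguments. Unset Strict Implicit. Unset Printing Implicit Defensive.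
Import Order.TTheory GRing.Theory Num.Theory.
Local Open Scope ring_scope.
Local Open Scope classical_set_scope.

Section Hilbert.
Variable R : realType.
Variable V : lmodType (R[i]).
Variable ip : V -> V -> R[i].   (* inner product, linear in the first argument *)

Definition hnorm (x : V) : R := Num.sqrt (complex.Re (ip x x)).

Definition h_cauchy (u : nat -> V) : Prop :=
  forall e : R, 0 < e -> exists N : nat, forall m k : nat,
    (N <= m)%N -> (N <= k)%N -> hnorm (u m - u k) < e.

Definition h_converges (u : nat -> V) (l : V) : Prop :=
  forall e : R, 0 < e -> exists N : nat, forall m : nat,
    (N <= m)%N -> hnorm (u m - l) < e.

Definition hilbert_space : Prop :=
  [/\ (forall (a : R[i]) (x y z : V), ip (a *: x + y) z = a * ip x z + ip y z),
      (forall x y : V, ip y x = conjc (ip x y)),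
      (forall x : V, 0 <= ip x x),
      (forall x : V, ip x x = 0 -> x = 0)
    & (forall u : nat -> V, h_cauchy u -> exists l, h_converges u l)].

Definition bounded_op (T : V -> V) : Prop :=
  (forall (a : R[i]) (x y : V), T (a *: x + y) = a *: T x + T y) /\
  (exists c : R, forall x : V, hnorm (T x) <= c * hnorm x).

Definition is_adjoint (T S : V -> V) : Prop :=
  forall x y : V, ip (T x) y = ip x (S y).

(* the adjoint T^* (unique when it exists; it always exists for T in B(H)) *)
Definition adj (T : V -> V) : V -> V :=
  match pselect (exists S, is_adjoint T S) with
  | left h => proj1_sig (cid h)
  | right _ => T
  end.

Definition opnorm (T : V -> V) : R :=
  sup [set hnorm (T x) | x in [set x : V | hnorm x <= 1]].

Definition opsum (n : nat) (F : 'I_n -> V -> V) : V -> V :=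
  fun v => \sum_(i < n) F i v.

Definition commutant (S : set (V -> V)) : set (V -> V) :=
  [set T | bounded_op T /\ forall A, S A -> forall v, T (A v) = A (T v)].

Definition von_neumann_algebra (M : set (V -> V)) : Prop :=
  [/\ M `<=` bounded_op,
      (forall A, M A -> M (adj A))
    & M = commutant (commutant M)].

Definition cyclic_vector (M : set (V -> V)) (xi : V) : Prop :=
  forall (v : V) (e : R), 0 < e -> exists A, M A /\ hnorm (v - A xi) < e.

End Hilbert.

(* Main.v *)
(* The decomposition is found by a Hahn-Banach argument on M^n.  With xi cyclic
   for M and phi(x) = Re sum_i <y_i x_i xi, xi>, the operators a_i, b_i of M'
   correspond to functionals f and phi - f on M^n with
     f(b* a_i) <= (sum_i |a_i xi|^2 + |b xi|^2) / 2  and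
     (phi - f)(b_i* a) <= (|a xi|^2 + sum_i |b_i xi|^2) / 2,
   so it suffices to bound phi by the sum of the two gauges attached to these
   inequalities.  This is where the hypothesis enters: if x_i is dominated in both
   senses by positive S, T in M, then z_i = T^(-1/2) x_i S^(-1/2) is both a row
   and a column contraction (Smith's argument that a bounded bimodule map is
   completely bounded when there is a cyclic vector), whence
     phi(x) = Re <(sum_i z_i y_i) S^(1/2) xi, T^(1/2) xi>
            <= (<S xi, xi> + <T xi, xi>) / 2. *)

Require Import Defs.
From HB Require Import structures.
From mathcomp Require Import all_boot all_order all_algebra.
From mathcomp Require Import complex.
From mathcomp Require Import boolp classical_sets reals.
From mathcomp Require Import functions ring lra.
Set Implicit Arguments. Unset Strict Implicit. Unset Printing Implicit Defensive.
Import Order.TTheory GRing.Theory Num.Theory.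
Local Open Scope ring_scope.
Local Open Scope classical_set_scope.

Local Notation "t *r x" := (t%:C%C *: x) (at level 40).

(** * Hahn-Banach *)

(** The maximum in the hypothesis dictates the sum of two gauges. A tuple comes with one pair of
    weights for its column inequality and an unrelated pair for its row inequality. Only common
    weights, the sums of the two, make the column norm and the row norm of the [z_i] at most 1
    together, and the final estimate at [xi] then separates again into one gauge value for each
    pair. The weights need not be invertible, so a multiple of the identity is added and removed in
    the limit. The bounds are arithmetic means rather than products of square roots because
    domination is then jointly linear in the tuple and its two weights, which is what makes the
    gauges sublinear. Functionals are only real-linear. The complex linearity of the operators they
    define is recovered from commutation with M, since M contains the complex scalars. *)

Lemma le_infD (R : realType) (A B : set R) (c : R) : A !=set0 -> B !=set0 ->
  (forall a b, A a -> B b -> c <= a + b) -> c <= inf A + inf B.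
Proof.
move=> A0 B0 h; rewrite -lerBlDr; apply: lb_le_inf => // a Aa.
rewrite lerBlDl -lerBlDr; apply: lb_le_inf => // b Bb.
by rewrite lerBlDl; exact: h.
Qed.

Lemma le_infZ (R : realType) (A : set R) (c t : R) : 0 < t -> A !=set0 ->
  (forall a, A a -> c <= t * a) -> c <= t * inf A.
Proof.
move=> t0 A0 h; rewrite -ler_pdivrMl//; apply: lb_le_inf => // a Aa.
by rewrite ler_pdivrMl//; exact: h.
Qed.

Section RealScaling.
Variables (R : realType) (W : lmodType R[i]).
Implicit Types (s t : R) (x y : W).

Lemma rscaleA s t x : s *r (t *r x) = (s * t) *r x.
Proof. by rewrite scalerA -rmorphM. Qed.

Lemma rscale1 x : 1 *r x = x.
Proof. by rewrite rmorph1 scale1r. Qed.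

Lemma rscaleN1 x : (-1) *r x = - x.
Proof. by rewrite rmorphN1 scaleN1r. Qed.

Lemma rscale0 x : 0 *r x = 0.
Proof. by rewrite rmorph0 scale0r. Qed.

Lemma rscaleDl s t x : (s + t) *r x = s *r x + t *r x.
Proof. by rewrite rmorphD scalerDl. Qed.

(** Functionals are defined on all of [W] and constrained only on [D], so that [M] can be used as a
    subset of the module [V -> V] without a module structure of its own. *)
Definition real_subspace (D : set W) :=
  [/\ D 0, forall x y, D x -> D y -> D (x + y) & forall t x, D x -> D (t *r x)].

(** Homogeneity is required as one inequality, for t > 0 only, which is easy to check for infima;
    applying it to t and to 1/t gives equality. *)
Definition sublinear_on (D : set W) (q : W -> R) :=
  (forall x y, D x -> D y -> q (x + y) <= q x + q y) /\
  (forall t x, 0 < t -> D x -> q (t *r x) <= t * q x).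

Definition real_linear_on (D : set W) (f : W -> R) :=
  (forall x y, D x -> D y -> f (x + y) = f x + f y) /\
  (forall t x, D x -> f (t *r x) = t * f x).

Lemma real_subspaceN D x : real_subspace D -> D x -> D (- x).
Proof. by move=> [_ _ DZ] Dx; rewrite -rscaleN1; exact: DZ. Qed.

Lemma real_linear_onN D f x : real_linear_on D f -> D x -> f (- x) = - f x.
Proof. by move=> [_ fZ] Dx; rewrite -rscaleN1 fZ// mulN1r. Qed.

Lemma real_linear_on_sum D f (I : Type) (r : seq I) (F : I -> W) :
  real_subspace D -> real_linear_on D f -> (forall i, D (F i)) ->
  f (\sum_(i <- r) F i) = \sum_(i <- r) f (F i).
Proof.
move=> [D0 DD _] [fD fZ] DF.
suff [] : D (\sum_(i <- r) F i) /\ f (\sum_(i <- r) F i) = \sum_(i <- r) f (F i) by [].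
elim/big_rec2: _ => [|i a b _ [Db <-]]; last by rewrite fD//; split=> //; exact: DD.
by split=> //; have := fZ 0 0 D0; rewrite scaler0 mul0r.
Qed.

Lemma sublinear_onZ D q t x : real_subspace D -> sublinear_on D q -> D x ->
  0 <= t -> q (t *r x) = t * q x.
Proof.
move=> [D0 _ DZ] [_ qZ] Dx; rewrite le_eqVlt => /predU1P[<-|t0].
  rewrite rscale0 mul0r.
  (* The factors 2 and 1/2 give [q 0 >= 0] and [q 0 <= 0]. *)
  have h1 := qZ 2 0 (ltr0Sn _ 1) D0; have h2 := qZ 2^-1 0 ltac:(by rewrite invr_gt0 ltr0Sn) D0.
  by move: h1 h2; rewrite !scaler0; lra.
apply/eqP; rewrite eq_le qZ//=.
have ti : 0 < t^-1 by rewrite invr_gt0.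
have := qZ _ _ ti (DZ t _ Dx).
by rewrite rscaleA mulVf ?gt_eqF// rscale1 ler_pdivlMl.
Qed.

Lemma sublinear_on_lb D q x : real_subspace D -> sublinear_on D q -> D x ->
  - q (- x) <= q x.
Proof.
move=> hD hq Dx; have [D0 _ _] := hD; have [qD _] := hq.
have := qD _ _ Dx (real_subspaceN hD Dx).
have := sublinear_onZ hD hq D0 (lexx 0).
by rewrite rscale0 mul0r addrN => ->; lra.
Qed.

(* The infimum of these values is a sublinear functional of x below q; a minimal
   q coincides with it, and the value at t = 1 then gives additivity. *)
Let shift (q : W -> R) (z x : W) : set R :=
  [set q (x + t *r z) - t * q z | t in [set t | 0 <= t]].

Let shift_lb D q z x : real_subspace D -> sublinear_on D q -> D z -> D x ->
  lbound (shift q z x) (- q (- x)).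
Proof.
move=> hD hq Dz Dx _ [t /= t0 <-].
have [_ DD DZ] := hD; have [qD _] := hq.
have Dtz := DZ t _ Dz.
have := qD _ _ (DD _ _ Dx Dtz) (real_subspaceN hD Dx).
rewrite addrAC subrr add0r (sublinear_onZ hD)//; lra.
Qed.

Let shift_le D q z x t : real_subspace D -> sublinear_on D q -> D z -> D x ->
  0 <= t -> inf (shift q z x) <= q (x + t *r z) - t * q z.
Proof.
move=> hD hq Dz Dx t0; apply: ge_inf; last by exists t.
by exists (- q (- x)); exact: (shift_lb hD).
Qed.

Let shift_nonempty q z x : shift q z x !=set0.
Proof. by exists (q (x + 0 *r z) - 0 * q z); exists 0 => /=. Qed.

Let shift_sublinear D q z : real_subspace D -> sublinear_on D q -> D z ->
  sublinear_on D (fun x => inf (shift q z x)).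
Proof.
move=> hD hq Dz; have [_ DD DZ] := hD; have [qD qZ] := hq; split.
  move=> x y Dx Dy; apply: le_infD => // _ _ [t /= t0 <-] [s /= s0 <-].
  apply: le_trans (shift_le hD hq Dz (DD _ _ Dx Dy) (addr_ge0 t0 s0)) _.
  rewrite rscaleDl addrACA.
  have := qD _ _ (DD _ _ Dx (DZ t _ Dz)) (DD _ _ Dy (DZ s _ Dz)).
  by lra.
move=> t x t0 Dx; apply: le_infZ => // _ [s /= s0 <-].
have ts : 0 <= t * s by rewrite mulr_ge0// ltW.
apply: le_trans (shift_le hD hq Dz (DZ t _ Dx) ts) _.
rewrite -rscaleA -scalerDr.
have := qZ _ _ t0 (DD _ _ Dx (DZ s _ Dz)).
by rewrite mulrBr mulrA lerD2r.
Qed.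

(** A minimal sublinear functional is linear, and Zorn's lemma supplies a minimal one below [q]. The
    relation [le] is reversed so that maximal means minimal; it is only a preorder because values
    outside [D] are ignored. *)
Theorem sublinear_minorant D q : real_subspace D -> sublinear_on D q ->
  exists2 f, real_linear_on D f & forall x, D x -> f x <= q x.
Proof.
move=> hD hq; have [D0 DD DZ] := hD.
pose T := {g : W -> R | sublinear_on D g /\ forall x, D x -> g x <= q x}.
pose le (g h : T) := `[< forall x, D x -> sval h x <= sval g x >].
have qT : sublinear_on D q /\ forall x, D x -> q x <= q x by [].
have [||A Atot|[g [hg gq]] gmin] := @ZL_preorder T (exist _ q qT) le.
- by move=> g; apply/asboolP.
- move=> f g h /asboolP fg /asboolP gh; apply/asboolP => x Dx.
  exact: le_trans (gh _ Dx) (fg _ Dx).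
(* A chain is bounded by its pointwise infimum, which is finite because every member is at least
   [- q (- x)]. *)
- have [->|/set0P[g0 Ag0]] := eqVneq A set0; first by exists (exist _ q qT).
  pose E x := [set sval g x | g in A].
  have lbE x : D x -> lbound (E x) (- q (- x)).
    move=> Dx _ [g Ag <-]; have [hg gq] := svalP g.
    apply: le_trans (sublinear_on_lb hD hg Dx).
    by rewrite lerN2; apply: gq; exact: real_subspaceN.
  have leE x g : D x -> A g -> inf (E x) <= sval g x.
    by move=> Dx Ag; apply: ge_inf; [exists (- q (- x)); exact: lbE | exists g].
  have E0 x : E x !=set0 by exists (sval g0 x), g0.
  have hE : sublinear_on D (fun x => inf (E x)) /\
            forall x, D x -> inf (E x) <= q x.
    split; [split|] => [x y Dx Dy|t x t0 Dx|x Dx].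
    (* Two members of the chain are comparable, and the smaller one serves both summands. *)
    + apply: le_infD => // _ _ [g Ag <-] [h Ah <-].
      have [/asboolP gh|/asboolP hg] := Atot _ _ Ag Ah.
        apply: le_trans (leE _ _ (DD _ _ Dx Dy) Ah) _.
        have [[hD' _] _] := svalP h.
        have := hD' _ _ Dx Dy; have := gh _ Dx; lra.
      apply: le_trans (leE _ _ (DD _ _ Dx Dy) Ag) _.
      have [[gD' _] _] := svalP g.
      have := gD' _ _ Dx Dy; have := hg _ Dy; lra.
    + apply: le_infZ => // _ [g Ag <-].
      apply: le_trans (leE _ _ (DZ _ _ Dx) Ag) _.
      by have [[_ gZ] _] := svalP g; exact: gZ.
    + by apply: le_trans (leE _ _ Dx Ag0) _; have [_] := svalP g0; exact.
  exists (exist _ (fun x => inf (E x)) hE) => g Ag; apply/asboolP => x Dx /=; exact: leE.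
- have gD x z : D x -> D z -> g (x + z) = g x + g z.
    move=> Dx Dz; have [gD _] := hg; apply/eqP; rewrite eq_le gD//=.
    have hs : sublinear_on D (fun x => inf (shift g z x)) /\
              forall x, D x -> inf (shift g z x) <= q x.
      split=> [|u Du]; first exact: shift_sublinear.
      apply: le_trans (shift_le hD hg Dz Du (lexx 0)) _.
      by rewrite rscale0 addr0 mul0r subr0 gq.
    have /gmin/asboolP/(_ _ Dx)/= h : le (exist _ g (conj hg gq))
        (exist _ (fun x => inf (shift g z x)) hs).
      apply/asboolP => u Du /=.
      apply: le_trans (shift_le hD hg Dz Du (lexx 0)) _.
      by rewrite rscale0 addr0 mul0r subr0.
    have := le_trans h (shift_le hD hg Dz Dx ler01).
    by rewrite rscale1 mul1r; lra.
  exists g => //; split=> // t x Dx.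
  have [t0|t0] := leP 0 t; first exact: (sublinear_onZ hD).
  have g0 : g 0 = 0 by have := gD _ _ D0 D0; rewrite addr0; lra.
  have : g (t *r x + (- t) *r x) = 0 by rewrite -rscaleDl subrr rscale0.
  rewrite (gD _ _ (DZ _ _ Dx) (DZ _ _ Dx)).
  have t0' : 0 <= - t by rewrite oppr_ge0 ltW.
  by rewrite (sublinear_onZ hD hg Dx t0') mulNr => /subr0_eq.
Qed.

(** Take a linear minorant g of the infimum over u of [p (x + u) + q u - f u], which is at least
    [- p (- x)] because [f <= p + q]. The choice u = 0 gives [g <= p]; the point -x with u = x gives
    [f - g <= q]. *)
Lemma linear_split D p q f : real_subspace D -> sublinear_on D p ->
  sublinear_on D q -> real_linear_on D f ->
  (forall x, D x -> f x <= p x + q x) ->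
  exists g, [/\ real_linear_on D g, forall x, D x -> g x <= p x &
                forall x, D x -> f x - g x <= q x].
Proof.
move=> hD hp hq hf fpq; have [D0 DD DZ] := hD.
have [pD pZ] := hp; have [qD qZ] := hq; have [fD fZ] := hf.
pose E x := [set p (x + u) + q u - f u | u in D].
have lbE x : D x -> lbound (E x) (- p (- x)).
  move=> Dx _ [u Du <-]; have := fpq _ Du.
  have := pD _ _ (DD _ _ Dx Du) (real_subspaceN hD Dx).
  by rewrite addrAC subrr add0r; lra.
have leE x u : D x -> D u -> inf (E x) <= p (x + u) + q u - f u.
  by move=> Dx Du; apply: ge_inf; [exists (- p (- x)); exact: lbE | exists u].
have E0 x : E x !=set0 by exists (p (x + 0) + q 0 - f 0), 0.
have hE : sublinear_on D (fun x => inf (E x)).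
  split=> [x y Dx Dy|t x t0 Dx].
    apply: le_infD => // _ _ [u Du <-] [v Dv <-].
    apply: le_trans (leE _ _ (DD _ _ Dx Dy) (DD _ _ Du Dv)) _.
    have := pD _ _ (DD _ _ Dx Du) (DD _ _ Dy Dv); rewrite addrACA.
    have := qD _ _ Du Dv; rewrite fD//; lra.
  apply: le_infZ => // _ [u Du <-].
  apply: le_trans (leE _ _ (DZ _ _ Dx) (DZ t _ Du)) _.
  rewrite -scalerDr fZ//; have := pZ _ _ t0 (DD _ _ Dx Du).
  have := qZ _ _ t0 Du; lra.
have [g hg gE] := sublinear_minorant hD hE; exists g; split=> // x Dx.
  have := le_trans (gE _ Dx) (leE _ _ Dx D0); rewrite addr0.
  have := sublinear_onZ hD hq D0 (lexx 0).
  by have := fZ 0 0 D0; rewrite rscale0 !mul0r => -> ->; lra.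
have DNx := real_subspaceN hD Dx.
have := le_trans (gE _ DNx) (leE _ _ DNx Dx); rewrite addNr.
have := sublinear_onZ hD hp D0 (lexx 0).
by rewrite rscale0 !mul0r (real_linear_onN hg)// => ->; lra.
Qed.

End RealScaling.

(** * The Riesz representation theorem *)

Lemma exists_inv_lt (R : realType) (e : R) : 0 < e ->
  exists N : nat, forall k, (N <= k)%N -> k.+1%:R^-1 < e.
Proof.
move=> e0; exists (Num.bound e^-1) => k Nk.
rewrite invf_plt ?posrE ?ltr0Sn//.
apply: lt_le_trans (archi_boundP _) _; first by rewrite invr_ge0 ltW.
by rewrite ler_nat; exact: leqW.
Qed.

(** * The real inner product of a Hilbert space *)

Section Hilbert.
Variables (R : realType) (V : lmodType R[i]) (ip : V -> V -> R[i]).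
Hypothesis hH : hilbert_space ip.
Implicit Types (x y z : V) (t c : R) (T S A : V -> V).

Local Notation hnorm := (hnorm ip).

(** All estimates use this real inner product. It loses nothing: the imaginary part of [ip x y] is
    the real part of [ip x (i y)]. *)
Definition rip x y : R := complex.Re (ip x y).

Lemma ripDl x y z : rip (x + y) z = rip x z + rip y z.
Proof.
have [h _ _ _ _] := hH; rewrite /rip -[x]scale1r h mul1r scale1r.
by case: (ip x z) (ip y z) => ? ? [].
Qed.

Lemma ipZl (a : R[i]) x y : ip (a *: x) y = a * ip x y.
Proof.
have [h _ _ _ _] := hH; have h0 : ip 0 y = 0.
  have := h 1 0 0 y; rewrite scale1r addr0 mul1r => /eqP.
  by rewrite -subr_eq subrr eq_sym => /eqP.
by have := h a x 0 y; rewrite addr0 h0 addr0.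
Qed.

Lemma ripZl t x y : rip (t *r x) y = t * rip x y.
Proof. by rewrite /rip ipZl; case: (ip x y) => a b /=; rewrite mul0r subr0. Qed.

Lemma ripC x y : rip x y = rip y x.
Proof. by have [_ h _ _ _] := hH; rewrite /rip h; case: (ip y x). Qed.

Lemma ripDr x y z : rip z (x + y) = rip z x + rip z y.
Proof. by rewrite !(ripC z) ripDl. Qed.

Lemma ripZr t x y : rip x (t *r y) = t * rip x y.
Proof. by rewrite !(ripC x) ripZl. Qed.

Lemma ripNl x y : rip (- x) y = - rip x y.
Proof. by rewrite -rscaleN1 ripZl mulN1r. Qed.

Lemma ripNr x y : rip x (- y) = - rip x y.
Proof. by rewrite !(ripC x) ripNl. Qed.

Lemma ripBl x y z : rip (x - y) z = rip x z - rip y z.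
Proof. by rewrite ripDl ripNl. Qed.

Lemma ripBr x y z : rip z (x - y) = rip z x - rip z y.
Proof. by rewrite ripDr ripNr. Qed.

Lemma rip0l x : rip 0 x = 0.
Proof. by rewrite -(rscale0 0) ripZl mul0r. Qed.

Lemma rip0r x : rip x 0 = 0.
Proof. by rewrite ripC rip0l. Qed.

Lemma rip_suml (I : Type) (r : seq I) (P : pred I) (F : I -> V) x :
  rip (\sum_(i <- r | P i) F i) x = \sum_(i <- r | P i) rip (F i) x.
Proof. by elim/big_rec2: _ => [|i a b _ <-]; rewrite ?rip0l ?ripDl. Qed.

Lemma rip_sumr (I : Type) (r : seq I) (P : pred I) (F : I -> V) x :
  rip x (\sum_(i <- r | P i) F i) = \sum_(i <- r | P i) rip x (F i).
Proof. by rewrite ripC rip_suml; apply: eq_bigr => i _; rewrite ripC. Qed.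

Lemma rip_ge0 x : 0 <= rip x x.
Proof. by have [_ _ h _ _] := hH; have := h x; rewrite lecE => /andP[]. Qed.

Lemma rip_eq0 x : rip x x = 0 -> x = 0.
Proof.
have [_ _ h h0 _] := hH => x0; apply: h0; have := h x; rewrite lecE => /andP[/eqP].
by move: x0; rewrite /rip; case: (ip x x) => a b /= -> ->.
Qed.

Lemma rip_i x y : rip ('i%C *: x) y = - rip x ('i%C *: y).
Proof.
have [_ h _ _ _] := hH; rewrite /rip ipZl (h ('i%C *: y) x) ipZl (h x y).
by case: (ip x y) => a b /=; rewrite !mul0r !mul1r; ring.
Qed.

Lemma ip_rip x y : ip x y = Complex (rip x y) (rip x ('i%C *: y)).
Proof.
have [_ h _ _ _] := hH; rewrite /rip (h ('i%C *: y) x) ipZl (h x y).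
by case: (ip x y) => a b /=; congr Complex; ring.
Qed.

Lemma rip_ext x y : (forall z, rip x z = rip y z) -> x = y.
Proof.
move=> h; apply/eqP; rewrite -subr_eq0; apply/eqP/rip_eq0.
by rewrite ripBl h subrr.
Qed.

Lemma hnorm_ge0 x : 0 <= hnorm x. Proof. exact: sqrtr_ge0. Qed.

Lemma sqr_hnorm x : hnorm x ^+ 2 = rip x x.
Proof. by rewrite sqr_sqrtr// rip_ge0. Qed.

Lemma hnorm_le x y : (hnorm x <= hnorm y) = (rip x x <= rip y y).
Proof. by rewrite /Defs.hnorm ler_psqrt ?qualifE/= ?rip_ge0. Qed.

Lemma hnorm_eq0 x : hnorm x = 0 -> x = 0.
Proof. by move=> h; apply: rip_eq0; rewrite -sqr_hnorm h expr0n. Qed.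

Lemma hnorm0 : hnorm 0 = 0.
Proof. by rewrite /Defs.hnorm -/(rip 0 0) rip0l sqrtr0. Qed.

Lemma hnorm_ltP x t : 0 < t -> (hnorm x < t) = (rip x x < t ^+ 2).
Proof. by move=> t0; rewrite -sqr_hnorm ltr_pXn2r ?nnegrE ?hnorm_ge0 ?ltW. Qed.

Lemma hnorm_leP x t : 0 <= t -> (hnorm x <= t) = (rip x x <= t ^+ 2).
Proof. by move=> t0; rewrite -sqr_hnorm ler_pXn2r ?nnegrE ?hnorm_ge0. Qed.

Lemma hnormZ t x : hnorm (t *r x) = `|t| * hnorm x.
Proof.
rewrite /Defs.hnorm -/(rip _ _) ripZl ripZr mulrA -expr2 sqrtrM ?sqr_ge0//.
by rewrite sqrtr_sqr.
Qed.

Lemma hnormN x : hnorm (- x) = hnorm x.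
Proof. by rewrite -rscaleN1 hnormZ normrN1 mul1r. Qed.

Lemma hnormB x y : hnorm (x - y) = hnorm (y - x).
Proof. by rewrite -hnormN opprB. Qed.

Lemma rip_amgm x y : rip x y <= 2^-1 * (rip x x + rip y y).
Proof. by have := rip_ge0 (x - y); rewrite ripBl !ripBr (ripC y x); lra. Qed.

Lemma rip_le x y : rip x y <= hnorm x * hnorm y.
Proof.
have [/hnorm_eq0 ->|x0] := eqVneq (hnorm x) 0; first by rewrite rip0l hnorm0 mul0r.
have [/hnorm_eq0 ->|y0] := eqVneq (hnorm y) 0; first by rewrite rip0r hnorm0 mulr0.
have a0 : 0 < hnorm x by rewrite lt_def x0 hnorm_ge0.
have b0 : 0 < hnorm y by rewrite lt_def y0 hnorm_ge0.
have := rip_ge0 (hnorm y *r x - hnorm x *r y).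
rewrite ripBl !ripBr !ripZl !ripZr -!sqr_hnorm (ripC y x) => h.
by rewrite -(ler_pM2l (mulr_gt0 a0 b0)); nra.
Qed.

Lemma abs_rip_le x y : `|rip x y| <= hnorm x * hnorm y.
Proof. by rewrite ler_norml rip_le andbT lerNl -ripNl -[hnorm x]hnormN rip_le. Qed.

Lemma hnormD x y : hnorm (x + y) <= hnorm x + hnorm y.
Proof.
rewrite hnorm_leP ?addr_ge0 ?hnorm_ge0// ripDl !ripDr (ripC y x).
by rewrite -!sqr_hnorm; have := rip_le x y; nra.
Qed.

(** Variational proof: the last hypothesis says that J = |e x|^2 - 2 f x is bounded below on [D],
    and the images under [e] of a minimizing sequence converge to the representing vector. The map
    [e] may fail to be injective and its image need not be closed, so [e] can be evaluation of
    operators at the cyclic vector. *)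
Lemma riesz_quadratic (W : lmodType R[i]) (D : set W) (e : W -> V) (f : W -> R) (C : R) :
  real_subspace D ->
  (forall x y : W, D x -> D y -> e (x + y) = e x + e y) ->
  (forall t (x : W), D x -> e (t *r x) = t *r e x) ->
  real_linear_on D f -> (forall x : W, D x -> 2 * f x <= C + rip (e x) (e x)) ->
  exists w, forall x : W, D x -> f x = rip (e x) w.
Proof.
move=> [D0 DD DZ] eD eZ [fD fZ] fC.
pose J (x : W) := rip (e x) (e x) - 2 * f x.
have JC : lbound [set J x | x in D] (- C).
  by move=> _ [x Dx <-]; rewrite /J; have := fC x Dx; lra.
set m := inf [set J x | x in D].
have mJ (x : W) : D x -> m <= J x by move=> Dx; apply: ge_inf; [exists (- C)|exists x].
have hasJ : has_inf [set J x | x in D] by split; [exists (J 0), 0|exists (- C)].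
have /choice[u hu] (k : nat) : exists x : W, D x /\ J x < m + k.+1%:R^-1.
  have k0 : 0 < (k.+1%:R^-1 : R) by rewrite invr_gt0 ltr0Sn.
  by have [_ [x Dx <-] lt] := inf_adherent k0 hasJ; exists x.
have [w uw] : exists w, h_converges ip (e \o u) w.
  have [_ _ _ _] := hH; apply=> eps eps0.
  (* By the parallelogram law and minimality at the midpoint, |e u_k - e u_l|^2 < 2/(k+1) + 2/(l+1),
     hence the factor 1/4. *)
  have [|N hN] := @exists_inv_lt R (4^-1 * eps ^+ 2).
    by rewrite mulr_gt0 ?invr_gt0 ?ltr0n ?exprn_gt0.
  exists N => k l Nk Nl /=; rewrite hnorm_ltP//.
  have [Dk Jk] := hu k; have [Dl Jl] := hu l.
  have := mJ _ (DZ 2^-1 _ (DD _ _ Dk Dl)).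
  rewrite /J eZ; last exact: DD.
  rewrite fZ; last exact: DD.
  rewrite eD// fD// ripZl ripZr ripBl !ripBr !ripDl !ripDr.
  have := hN _ Nk; have := hN _ Nl; have := Jl; have := hu k; rewrite /J => -[_].
  rewrite (ripC (e (u l)) (e (u k))).
  by move: (k.+1%:R^-1) (l.+1%:R^-1) (eps ^+ 2) => ? ? ?; lra.
exists w => x Dx; set a := rip (e x) (e x).
have a0 : 0 <= a := rip_ge0 _.
pose d := rip (e x) w - f x.
(* First variation: the right side is the limit of J(u_k + t x) - J(u_k). The test value t =
   -d/(a+1) forces d = 0; the added 1 covers the case [e x = 0]. *)
suff h t : 0 <= t ^+ 2 * a + 2 * t * d.
  have a1 : 0 < a + 1 by lra.
  have := h (- d / (a + 1)).
  have -> : (- d / (a + 1)) ^+ 2 * a + 2 * (- d / (a + 1)) * d =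
    - (d ^+ 2 * (a + 2)) / (a + 1) ^+ 2 by field; rewrite gt_eqF.
  rewrite mulNr oppr_ge0 pmulr_lle0 ?invr_gt0 ?exprn_gt0//.
  rewrite pmulr_lle0; last by lra.
  by rewrite le_eqVlt ltNge sqr_ge0 orbF sqrf_eq0 subr_eq0 => /eqP ->.
apply/ler_addgt0Pr => eps eps0.
pose b := 2 * `|t| * hnorm (e x) + 1.
have b0 : 0 < b by rewrite ltr_wpDl// !mulr_ge0 ?hnorm_ge0.
have e2 : 0 < eps / 2 by lra.
have [N1 hN1] := exists_inv_lt e2.
have [N2 hN2] := uw (eps / 2 / b) ltac:(by rewrite divr_gt0).
pose k := maxn N1 N2.
have hk1 : hnorm (e (u k) - w) < eps / 2 / b := hN2 k (leq_maxr _ _).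
pose kk : R := k.+1%:R^-1.
have hk2 : kk < eps / 2 := hN1 k (leq_maxl _ _).
have [Dk Jk] := hu k.
have := mJ _ (DD _ _ Dk (DZ t _ Dx)).
rewrite /J eD//; last exact: DZ.
rewrite fD//; last exact: DZ.
rewrite eZ// fZ// !ripDl !ripDr !ripZl !ripZr (ripC (e x) (e (u k))) -/a.
move: Jk; rewrite /J -/kk => Jk h1.
have : 2 * t * rip (e (u k) - w) (e x) <= eps / 2.
  apply: le_trans (ler_norm _) _; rewrite !normrM ger0_norm//.
  apply: (@le_trans _ _ (2 * `|t| * (eps / 2 / b * hnorm (e x)))).
    apply: ler_wpM2l; first by rewrite mulr_ge0.
    apply: le_trans (abs_rip_le _ _) _; apply: ler_wpM2r; first exact: hnorm_ge0.
    exact: ltW.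
  rewrite -mulrA [X in X <= _](_ : _ = eps / 2 * ((b - 1) / b)).
    by apply: ler_piMr; [exact: ltW|rewrite ler_pdivrMr//; lra].
  by rewrite /b; field; rewrite gt_eqF.
by rewrite ripBl (ripC w) /d; move: kk hk2 Jk => kk; lra.
Qed.

Lemma riesz (W : lmodType R[i]) (D : set W) (e : W -> V) (f : W -> R) (C : R) :
  real_subspace D ->
  (forall x y : W, D x -> D y -> e (x + y) = e x + e y) ->
  (forall t (x : W), D x -> e (t *r x) = t *r e x) ->
  real_linear_on D f -> (forall x : W, D x -> f x <= C * hnorm (e x)) ->
  exists w, forall x : W, D x -> f x = rip (e x) w.
Proof.
move=> hD eD eZ hf fC; apply: (riesz_quadratic (C := C ^+ 2)) => // x Dx.
by rewrite -sqr_hnorm; have := fC x Dx; have := sqr_ge0 (hnorm (e x) - C); nra.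
Qed.

(** * Bounded operators and adjoints *)

Lemma ipZr (a : R[i]) x y : ip x (a *: y) = (conjc a) * ip x y.
Proof.
have [_ h _ _ _] := hH; rewrite (h (a *: y) x) ipZl (h y x).
by case: (ip y x) a => p q [a b] /=; congr Complex; ring.
Qed.

Lemma ipDr x y z : ip z (x + y) = ip z x + ip z y.
Proof.
have [h1 h _ _ _] := hH; rewrite (h (x + y) z) (h x z) (h y z).
rewrite -{1}[x]scale1r h1 mul1r.
by case: (ip x z) (ip y z) => p q [a b] /=; congr Complex; ring.
Qed.

Lemma ip_ext x y : (forall z, ip z x = ip z y) -> x = y.
Proof. by move=> h; apply: rip_ext => z; rewrite !(ripC _ z) /rip h. Qed.

Lemma is_adjoint_rip T S : is_adjoint ip T S ->
  forall x y, rip (T x) y = rip x (S y).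
Proof. by move=> h x y; rewrite /rip h. Qed.

Lemma rip_is_adjoint T S : (forall x, T ('i%C *: x) = 'i%C *: T x) ->
  (forall x y, rip (T x) y = rip x (S y)) -> is_adjoint ip T S.
Proof.
move=> Ti TS x y; rewrite !ip_rip TS; congr Complex.
apply: oppr_inj; rewrite -!rip_i -Ti; exact: TS.
Qed.

Lemma is_adjoint_linear T S : is_adjoint ip T S ->
  forall (a : R[i]) x y, S (a *: x + y) = a *: S x + S y.
Proof. by move=> h a x y; apply: ip_ext => z; rewrite -h !ipDr !ipZr !h. Qed.

Lemma bounded_opD T x y : bounded_op ip T -> T (x + y) = T x + T y.
Proof. by move=> [h _]; rewrite -{1}[x]scale1r h scale1r. Qed.

Lemma bounded_op0 T : bounded_op ip T -> T 0 = 0.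
Proof.
move=> hT; have /eqP := bounded_opD 0 0 hT.
by rewrite addr0 -subr_eq subrr eq_sym => /eqP.
Qed.

Lemma bounded_opZ T (a : R[i]) x : bounded_op ip T -> T (a *: x) = a *: T x.
Proof. by move=> hT; have [h _] := hT; have := h a x 0; rewrite !addr0 bounded_op0 ?addr0. Qed.

Lemma bounded_opN T x : bounded_op ip T -> T (- x) = - T x.
Proof. by move=> hT; rewrite -scaleN1r bounded_opZ// scaleN1r. Qed.

Lemma bounded_opB T x y : bounded_op ip T -> T (x - y) = T x - T y.
Proof. by move=> hT; rewrite bounded_opD// bounded_opN. Qed.

Lemma bounded_op_bound T : bounded_op ip T ->
  exists2 c, 0 < c & forall x, hnorm (T x) <= c * hnorm x.
Proof.
move=> [_ [c hc]]; exists (`|c| + 1); first by rewrite ltr_wpDl.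
move=> x; apply: le_trans (hc x) _; apply: ler_wpM2r; first exact: hnorm_ge0.
by rewrite ler_wpDr// ler_norm.
Qed.

Lemma hnormZc (a : R[i]) x :
  hnorm (a *: x) = Num.sqrt (complex.Re a ^+ 2 + complex.Im a ^+ 2) * hnorm x.
Proof.
rewrite /Defs.hnorm -sqrtrM ?addr_ge0 ?sqr_ge0// ipZl ipZr; congr Num.sqrt.
have [_ _ /(_ x) + _ _] := hH; rewrite lecE => /andP[/eqP + _].
by case: (ip x x) => p q /= ->; case: a => a b /=; ring.
Qed.

Lemma bounded_op_id : bounded_op ip id.
Proof. by split=> //; exists 1 => x; rewrite mul1r. Qed.

Lemma bounded_op_comp T S : bounded_op ip T -> bounded_op ip S -> bounded_op ip (T \o S).
Proof.
move=> hT hS; split=> [a x y|] /=.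
  by rewrite bounded_opD// bounded_opZ// bounded_opD// bounded_opZ.
have [c c0 hc] := bounded_op_bound hT; have [d d0 hd] := bounded_op_bound hS.
exists (c * d) => x /=; apply: le_trans (hc _) _.
by rewrite -mulrA ler_wpM2l// ltW.
Qed.

Lemma add_opE T S x : (T + S) x = T x + S x. Proof. by []. Qed.

Lemma scale_opE (a : R[i]) T x : (a *: T) x = a *: T x. Proof. by []. Qed.

Lemma bounded_op_add T S : bounded_op ip T -> bounded_op ip S -> bounded_op ip (T + S).
Proof.
move=> hT hS; split=> [a x y|].
  rewrite !add_opE !(bounded_opD _ _ hT, bounded_opD _ _ hS).
  by rewrite !(bounded_opZ _ _ hT, bounded_opZ _ _ hS) scalerDr addrACA.
have [c c0 hc] := bounded_op_bound hT; have [d d0 hd] := bounded_op_bound hS.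
exists (c + d) => x; apply: le_trans (hnormD _ _) _.
by rewrite mulrDl lerD.
Qed.

Lemma bounded_op_scale (a : R[i]) T : bounded_op ip T -> bounded_op ip (a *: T).
Proof.
move=> hT; split=> [b x y|].
  by rewrite !scale_opE (bounded_opD _ _ hT) (bounded_opZ _ _ hT) scalerDr !scalerA mulrC.
have [c c0 hc] := bounded_op_bound hT.
exists (Num.sqrt (complex.Re a ^+ 2 + complex.Im a ^+ 2) * c) => x.
by rewrite scale_opE hnormZc -mulrA ler_wpM2l// sqrtr_ge0.
Qed.

Lemma adjP T : bounded_op ip T -> is_adjoint ip T (adj ip T).
Proof.
move=> hT; rewrite /adj; case: pselect => [h|[]]; first by case: cid.
suff /choice[S hS] (y : V) : exists w, forall x, rip (T x) y = rip x w.
  exists S; apply: rip_is_adjoint => // x; exact: bounded_opZ.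
have [c c0 hc] := bounded_op_bound hT.
have [|||||w hw] := @riesz V setT id (fun x => rip (T x) y) (c * hnorm y) => //.
- by split=> [x z _ _|t x _]; rewrite ?(bounded_opD _ _ hT) ?(bounded_opZ _ _ hT) ?ripDl ?ripZl.
- move=> x _; apply: le_trans (rip_le _ _) _; rewrite mulrAC.
  by rewrite ler_wpM2r// hnorm_ge0.
- by exists w => x; rewrite hw.
Qed.

Lemma is_adjoint_bounded T S : is_adjoint ip T S -> bounded_op ip T -> bounded_op ip S.
Proof.
move=> TS hT; split; first exact: is_adjoint_linear TS.
have [c c0 hc] := bounded_op_bound hT; exists c => y.
have [S0|S0] := eqVneq (hnorm (S y)) 0.
  by rewrite S0 mulr_ge0 ?hnorm_ge0 ?ltW.
have Sp : 0 < hnorm (S y) by rewrite lt_def S0 hnorm_ge0.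
rewrite -(ler_pM2l Sp) -expr2 sqr_hnorm -(is_adjoint_rip TS).
apply: le_trans (rip_le _ _) _; rewrite mulrCA mulrA ler_wpM2r ?hnorm_ge0//.
Qed.

Lemma adj_bounded T : bounded_op ip T -> bounded_op ip (adj ip T).
Proof. by move=> hT; exact: is_adjoint_bounded (adjP hT) hT. Qed.

Lemma rip_adj T x y : bounded_op ip T -> rip (T x) y = rip x (adj ip T y).
Proof. by move=> hT; exact: is_adjoint_rip (adjP hT) _ _. Qed.

Lemma rip_adjl T x y : bounded_op ip T -> rip (adj ip T x) y = rip x (T y).
Proof. by move=> hT; rewrite ripC -rip_adj// ripC. Qed.

(** * Square roots of invertible positive operators *)

(** Bernoulli's inequality r^k (1 + k (1 - r)) <= 1 drives C r^k below any positive number. The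
    square root iteration passes to the limit through this lemma, with errors bounded by C r^k. *)
Lemma geometric_le0 (r C a : R) : 0 <= r -> r < 1 ->
  (forall k, a <= C * r ^+ k) -> a <= 0.
Proof.
move=> r0 r1 h; have [//|a0] := leP a 0.
have C0 : 0 < C by have := h 0; rewrite expr0 mulr1; exact: lt_le_trans.
have bern k : r ^+ k * (1 + k%:R * (1 - r)) <= 1.
  elim: k => [|k IH]; first by rewrite expr0 mul0r addr0 mulr1.
  apply: le_trans IH; rewrite exprSr -mulrA ler_wpM2l ?exprn_ge0//.
  rewrite -[k.+1]addn1 natrD; have : (0 : R) <= k%:R := ler0n _ _.
  move: (k%:R : R) => x x0.
  have : 0 <= (1 - r) ^+ 2 * (1 + x) by rewrite mulr_ge0 ?sqr_ge0 ?addr_ge0.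
  by nra.
have [|N hN] := @exists_inv_lt R (a * (1 - r) / C).
  by rewrite divr_gt0// mulr_gt0// subr_gt0.
have := hN N (leqnn _); rewrite invf_plt ?posrE ?ltr0Sn ?divr_gt0 ?mulr_gt0 ?subr_gt0//.
rewrite invf_div ltr_pdivrMr ?mulr_gt0 ?subr_gt0// => hk.
have := h N; have := bern N; have : 0 <= r ^+ N by exact: exprn_ge0.
rewrite -[N.+1]addn1 natrD in hk; move: (r ^+ N) hk => x.
have : (0 : R) <= N%:R := ler0n _ _.
move: (N%:R : R) => n n0 hk x0 hb ha.
have : C * x * ((n + 1) * (1 - r)) <= C.
  by rewrite -mulrA ger_pMr//; nra.
have : a * ((n + 1) * (1 - r)) <= C * x * ((n + 1) * (1 - r)).
  by apply: ler_wpM2r => //; nra.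
by nra.
Qed.

Lemma h_converges_cauchy (u : nat -> V) (r C : R) : 0 <= r -> r < 1 ->
  (forall k m, hnorm (u (k + m)%N - u k) <= C * r ^+ k) ->
  exists l, forall k, hnorm (u k - l) <= C * r ^+ k.
Proof.
move=> r0 r1 h.
have C0 : 0 <= C.
  by have := h 0%N 0%N; rewrite subrr hnorm0 expr0 mulr1.
have small e : 0 < e -> exists N, C * r ^+ N < e.
  move=> e0; apply: contrapT => /forallNP hn.
  suff : e <= 0 by rewrite leNgt e0.
  by apply: (@geometric_le0 r C) => // k; rewrite leNgt; exact/negP/hn.
have [_ _ _ _ complete] := hH.
have [e e0|l hl] := complete u.
  have [N hN] := small (e / 2) ltac:(by rewrite divr_gt0).
  exists N => m k Nm Nk.
  have hm := h N (m - N)%N; have hk := h N (k - N)%N.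
  rewrite !subnKC// in hm hk.
  have -> : u m - u k = (u m - u N) - (u k - u N) by rewrite opprB addrA subrK.
  apply: le_lt_trans (hnormD _ _) _; rewrite hnormN; lra.
exists l => k; apply/ler_addgt0Pr => e e0; have [N hN] := hl e e0.
have -> : u k - l = - (u (k + N)%N - u k) + (u (k + N)%N - l).
  by rewrite opprB addrA subrK.
apply: le_trans (hnormD _ _) _; rewrite hnormN lerD//.
by rewrite ltW// hN// leq_addl.
Qed.

(* The fixed point y of y = (A + y^2) / 2 satisfies (1 - y)^2 = 1 - A ; the
   iteration is a contraction on the ball of radius r. *)
Lemma quadratic_fixpoint A (r : R) : bounded_op ip A -> 0 <= r -> r < 1 ->
  (forall x y, rip (A x) y = rip x (A y)) ->
  (forall x, hnorm (A x) <= r * hnorm x) ->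
  exists y : V -> V, [/\ forall u v, rip (y u) v = rip u (y v),
    forall u, hnorm (y u) <= r * hnorm u,
    forall u, 2 *r y u = A u + y (y u) &
    forall B, bounded_op ip B -> (forall u, A (B u) = B (A u)) ->
      forall u, y (B u) = B (y u)].
Proof.
move=> hA r0 r1 Asym Ar.
pose F (y : V -> V) u := 2^-1 *r (A u + y (y u)).
pose Y k := iter k F (fun=> 0).
have YS k u : Y k.+1 u = 2^-1 *r (A u + Y k (Y k u)) by [].
have Ysym k u v : rip (Y k u) v = rip u (Y k v).
  elim: k u v => [|k IH] u v; first by rewrite rip0l rip0r.
  by rewrite !YS ripZl ripZr ripDl ripDr Asym !IH.
have YB k B : bounded_op ip B -> (forall u, A (B u) = B (A u)) ->
    forall u, Y k (B u) = B (Y k u).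
  move=> hB AB; elim: k => [|k IH] u; first by rewrite /= bounded_op0.
  by rewrite !YS AB !IH (bounded_opZ _ _ hB) (bounded_opD _ _ hB).
(* Symmetry alone forces additivity, without another induction. *)
have YD k u v : Y k (u + v) = Y k u + Y k v.
  by apply: rip_ext => z; rewrite ripDl !Ysym ripDl.
have YN k u : Y k (- u) = - Y k u.
  by apply: rip_ext => z; rewrite ripNl !Ysym ripNl.
have Yr k u : hnorm (Y k u) <= r * hnorm u.
  elim: k u => [|k IH] u; first by rewrite /= hnorm0 mulr_ge0// hnorm_ge0.
  rewrite YS hnormZ ger0_norm ?invr_ge0//.
  have := hnormD (A u) (Y k (Y k u)); have := Ar u; have := IH u; have := IH (Y k u).
  have : r * hnorm (Y k u) <= r * hnorm u.
    by apply: ler_wpM2l => //; apply: le_trans (IH u) _; rewrite ler_piMl ?hnorm_ge0// ltW.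
  by lra.
have Ydiff k m u : hnorm (Y (k + m)%N u - Y k u) <= hnorm u * r ^+ k.
  elim: k u => [|k IH] u.
    rewrite expr0 mulr1 add0n [Y 0%N u]/= subr0; apply: le_trans (Yr m u) _.
    by rewrite ler_piMl ?hnorm_ge0// ltW.
  rewrite addSn !YS -scalerBr opprD addrACA subrr add0r hnormZ ger0_norm ?invr_ge0//.
  (* Each of the two terms is at most r times the bound for index k, and the factor 1/2 of the
     iteration compensates for there being two. *)
  have -> : Y (k + m)%N (Y (k + m)%N u) - Y k (Y k u) =
    Y (k + m)%N (Y (k + m)%N u - Y k u) + (Y (k + m)%N (Y k u) - Y k (Y k u)).
    by rewrite YD YN addrA subrK.
  have h1 := Yr (k + m)%N (Y (k + m)%N u - Y k u); have h2 := IH u.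
  have h3 := IH (Y k u); have h4 := Yr k u.
  have h5 := hnormD (Y (k + m)%N (Y (k + m)%N u - Y k u)) (Y (k + m)%N (Y k u) - Y k (Y k u)).
  have rk : 0 <= r ^+ k by exact: exprn_ge0.
  have h6 : r * hnorm (Y (k + m)%N u - Y k u) <= r * (hnorm u * r ^+ k) by exact: ler_wpM2l.
  have h7 : hnorm (Y k u) * r ^+ k <= r * hnorm u * r ^+ k by exact: ler_wpM2r.
  rewrite exprS; lra.
have /choice[y hy] (u : V) : exists l, forall k, hnorm (Y k u - l) <= hnorm u * r ^+ k.
  by apply: h_converges_cauchy => // k m; exact: Ydiff.
have hy' k u : hnorm (y u - Y k u) <= hnorm u * r ^+ k by rewrite hnormB.
have small C z : (forall k, hnorm z <= C * r ^+ k) -> z = 0.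
  move=> h; apply: hnorm_eq0; apply/eqP.
  by rewrite eq_le hnorm_ge0 andbT; exact: geometric_le0 h.
exists y; split.
- move=> u v; apply/eqP; rewrite -subr_eq0 -normr_eq0 eq_le normr_ge0 andbT.
  apply: (@geometric_le0 r (2 * (hnorm u * hnorm v))) => // k.
  have -> : rip (y u) v - rip u (y v) = rip (y u - Y k u) v - rip u (y v - Y k v).
    by rewrite ripBl ripBr Ysym; lra.
  apply: le_trans (ler_normB _ _) _.
  have h1 := le_trans (abs_rip_le (y u - Y k u) v) (ler_wpM2r (hnorm_ge0 v) (hy' k u)).
  have h2 := le_trans (abs_rip_le u (y v - Y k v)) (ler_wpM2l (hnorm_ge0 u) (hy' k v)).
  lra.
- move=> u; rewrite -subr_le0; apply: (@geometric_le0 r (hnorm u)) => // k.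
  have := hnormD (y u - Y k u) (Y k u); rewrite subrK.
  have := hy' k u; have := Yr k u; lra.
- move=> u; apply/eqP; rewrite -subr_eq0; apply/eqP.
  apply: (@small (4 * hnorm u + hnorm (y u))) => k.
  have -> : 2 *r y u - (A u + y (y u)) =
    2 *r (y u - Y k.+1 u) - ((y (y u) - Y k (y u)) + (Y k (y u - Y k u))).
    rewrite scalerBr YS rscaleA divff ?gt_eqF// rscale1 YD YN addrA subrK.
    by rewrite -!addrA -!opprD addrACA addrN addr0.
  have h1 := hnormD (2 *r (y u - Y k.+1 u)) (- ((y (y u) - Y k (y u)) + (Y k (y u - Y k u)))).
  have h2 := hnormD (y (y u) - Y k (y u)) (Y k (y u - Y k u)).
  rewrite hnormN hnormZ ger0_norm// in h1.
  have h3 := hy' k.+1 u; have h4 := hy' k (y u); have h5 := hy' k u.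
  have h6 := Yr k (y u - Y k u).
  have rk : 0 <= r ^+ k by exact: exprn_ge0.
  have h7 : r * hnorm (y u - Y k u) <= hnorm (y u - Y k u).
    by rewrite ler_piMl ?hnorm_ge0// ltW.
  have h8 : hnorm u * r ^+ k.+1 <= hnorm u * r ^+ k.
    by rewrite exprS ler_wpM2l ?hnorm_ge0// ler_piMl// ltW.
  have h9 : 0 <= hnorm u * r ^+ k by rewrite mulr_ge0// hnorm_ge0.
  lra.
- move=> B hB AB u; apply/eqP; rewrite -subr_eq0; apply/eqP.
  have [c c0 hc] := bounded_op_bound hB.
  apply: (@small (hnorm (B u) + c * hnorm u)) => k.
  have -> : y (B u) - B (y u) = (y (B u) - Y k (B u)) - B (y u - Y k u).
    by rewrite (bounded_opB _ _ hB) (YB _ _ hB AB) opprB addrA subrK.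
  apply: le_trans (hnormD _ _) _; rewrite hnormN mulrDl lerD//.
  by apply: le_trans (hc _) _; rewrite -mulrA ler_wpM2l// ltW.
Qed.

Lemma rip_bounded_op T c : (forall x, T ('i%C *: x) = 'i%C *: T x) ->
  (forall x y, rip (T x) y = rip x (T y)) ->
  (forall x, hnorm (T x) <= c * hnorm x) -> bounded_op ip T.
Proof.
by move=> Ti Tsym Tc; split; [exact: is_adjoint_linear (rip_is_adjoint Ti Tsym)|exists c].
Qed.

(** With A = 1 - S/c, the fixed point y satisfies (1 - y)^2 = S/c, so s = c^(1/2) (1 - y) is the
    root. Since y has norm at most r < 1, s is bounded below, hence injective; Riesz applied with
    [e := s] makes it surjective. The commutation clause is what later places s and its inverse in
    M. *)
Lemma invertible_sqrt S (eps : R) : bounded_op ip S ->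
  (forall x y, rip (S x) y = rip x (S y)) -> 0 < eps ->
  (forall x, eps * rip x x <= rip (S x) x) ->
  exists s t : V -> V, [/\ bounded_op ip s /\ bounded_op ip t,
    (forall x y, rip (s x) y = rip x (s y)) /\
    (forall x y, rip (t x) y = rip x (t y)),
    forall x, s (s x) = S x,
    (forall x, s (t x) = x) /\ (forall x, t (s x) = x) &
    forall B, bounded_op ip B -> (forall x, S (B x) = B (S x)) ->
      (forall x, s (B x) = B (s x)) /\ (forall x, t (B x) = B (t x))].
Proof.
move=> hS Ssym eps0 Spos.
have [K0 K00 hK0] := bounded_op_bound hS.
pose K := K0 + eps; have hK x : hnorm (S x) <= K * hnorm x.
  by apply: le_trans (hK0 _) _; rewrite ler_wpM2r ?hnorm_ge0// /K lerDl ltW.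
have Kp : 0 < K by rewrite addr_gt0.
have epsK : eps < K by rewrite /K ltrDr.
(* This c minimizes the bound 1 - 2 eps/c + K^2/c^2 for |A|^2, whose minimum is 1 - (eps/K)^2. *)
pose c := K ^+ 2 / eps; have c0 : 0 < c by rewrite divr_gt0 ?exprn_gt0.
pose r2 := 1 - (eps / K) ^+ 2.
have eK : 0 < eps / K < 1 by rewrite divr_gt0// ltr_pdivrMr// mul1r.
have r20 : 0 <= r2 by rewrite /r2; move: eK => /andP[]; nra.
pose r := Num.sqrt r2; have r0 : 0 <= r := sqrtr_ge0 _.
have rr : r ^+ 2 = r2 by rewrite sqr_sqrtr.
have r1 : r < 1.
  by rewrite -(@ltr_pXn2r _ 2)// ?nnegrE// rr expr1n /r2; move: eK => /andP[]; nra.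
pose A := (id : V -> V) + ((- c^-1)%:C%C *: S).
have hA : bounded_op ip A.
  exact: bounded_op_add bounded_op_id (bounded_op_scale _ hS).
have AE x : A x = x + (- c^-1) *r S x by [].
have Asym x y : rip (A x) y = rip x (A y).
  by rewrite !AE ripDl ripDr ripZl ripZr Ssym.
have Ar x : hnorm (A x) <= r * hnorm x.
  rewrite hnorm_leP ?mulr_ge0 ?hnorm_ge0// exprMn rr sqr_hnorm.
  rewrite AE ripDl !ripDr !ripZl !ripZr (ripC x (S x)).
  have h1 : rip (S x) (S x) <= K ^+ 2 * rip x x.
    by rewrite -!sqr_hnorm -exprMn ler_pXn2r ?nnegrE ?mulr_ge0 ?hnorm_ge0// ltW.
  have -> : r2 * rip x x = rip x x - 2 * c^-1 * (eps * rip x x) + c^-1 * (c^-1 * (K ^+ 2 * rip x x)).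
    by rewrite /r2 /c; field; rewrite !gt_eqF.
  have ci : 0 < c^-1 by rewrite invr_gt0.
  have h2 : c^-1 * (c^-1 * rip (S x) (S x)) <= c^-1 * (c^-1 * (K ^+ 2 * rip x x)).
    by rewrite !ler_wpM2l// ltW.
  have h3 : c^-1 * (eps * rip x x) <= c^-1 * rip (S x) x by rewrite ler_wpM2l// ltW.
  lra.
have [y [ysym yr yfix yB]] := quadratic_fixpoint hA r0 r1 Asym Ar.
pose sc := Num.sqrt c; have sc0 : 0 < sc by rewrite sqrtr_gt0.
pose s x := sc *r (x - y x).
have ssym u v : rip (s u) v = rip u (s v).
  by rewrite ripZl ripZr ripBl ripBr ysym.
have sB B : bounded_op ip B -> (forall x, S (B x) = B (S x)) -> forall x, s (B x) = B (s x).
  move=> hB SB x; rewrite /s yB//; last first.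
    by move=> u; rewrite !AE SB (bounded_opD _ _ hB) (bounded_opZ _ _ hB).
  by rewrite (bounded_opZ _ _ hB) (bounded_opB _ _ hB).
have iB : bounded_op ip ('i%C *: (id : V -> V)) := bounded_op_scale _ bounded_op_id.
have Si x : S ('i%C *: x) = 'i%C *: S x by rewrite (bounded_opZ _ _ hS).
have si x : s ('i%C *: x) = 'i%C *: s x by exact: (sB _ iB Si).
have yD u v : y (u + v) = y u + y v.
  by apply: rip_ext => z; rewrite ripDl !ysym ripDl.
have yZ t u : y (t *r u) = t *r y u.
  by apply: rip_ext => z; rewrite ripZl !ysym ripZl.
have yN u : y (- u) = - y u by rewrite -rscaleN1 yZ rscaleN1.
have sS x : s (s x) = S x.
  rewrite /s yZ yD yN -scalerBr rscaleA.
  have -> : sc * sc = c by rewrite -expr2 sqr_sqrtr// ltW.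
  have -> : x - y x - (y x - y (y x)) = x - A x.
    by rewrite -[A x](addrK (y (y x))) -yfix rscaleDl rscale1 !opprD !opprK !addrA.
  rewrite AE opprD addrA subrr add0r -scaleNr -rmorphN opprK.
  by rewrite rscaleA divff ?gt_eqF// rscale1.
pose d := sc * (1 - r); have d0 : 0 < d by rewrite mulr_gt0// subr_gt0.
have sd x : d * hnorm x <= hnorm (s x).
  rewrite hnormZ gtr0_norm// -mulrA ler_pM2l//.
  by have := hnormD (x - y x) (y x); rewrite subrK; have := yr x; lra.
have sle x : hnorm (s x) <= (sc * (1 + r)) * hnorm x.
  rewrite hnormZ gtr0_norm// -mulrA ler_pM2l//.
  by apply: le_trans (hnormD _ _) _; rewrite hnormN; have := yr x; lra.
have hs : bounded_op ip s by exact: rip_bounded_op sle.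
have sinj u v : s u = s v -> u = v.
  move=> suv; apply/eqP; rewrite -subr_eq0; apply/eqP/hnorm_eq0/eqP.
  rewrite eq_le hnorm_ge0 andbT -(pmulr_rle0 _ d0).
  by apply: le_trans (sd _) _; rewrite (bounded_opB _ _ hs) suv subrr hnorm0.
have /choice[t st] (u : V) : exists w, s w = u.
  have [|||||w hw] := @riesz V setT s (fun x => rip x u) (hnorm u / d) => //.
  - by move=> *; rewrite (bounded_opD _ _ hs).
  - by move=> *; rewrite (bounded_opZ _ _ hs).
  - by split=> [x z _ _|a x _]; rewrite ?ripDl ?ripZl.
  - move=> x _; apply: le_trans (rip_le _ _) _.
    by rewrite mulrC -mulrA ler_wpM2l ?hnorm_ge0// ler_pdivlMl.
  - by exists w; apply: rip_ext => z; rewrite ssym ripC -hw// ripC.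
have ts x : t (s x) = x by apply: sinj; rewrite st.
have tB B : bounded_op ip B -> (forall x, S (B x) = B (S x)) -> forall x, t (B x) = B (t x).
  by move=> hB SB x; apply: sinj; rewrite (sB _ hB SB) !st.
have tsym u v : rip (t u) v = rip u (t v) by rewrite -{1}[v]st -ssym st.
have ht : bounded_op ip t.
  apply: (@rip_bounded_op _ d^-1) => [x||x]; [exact: (tB _ iB Si)|exact: tsym|].
  by rewrite -ler_pdivrMl ?invr_gt0// invrK -{2}[x]st.
exists s, t; split=> // B hB SB; split; [exact: sB|exact: tB].
Qed.

(** * Von Neumann algebras with a cyclic vector *)

Lemma adj_unique T S : bounded_op ip T ->
  (forall x y, rip (T x) y = rip x (S y)) -> adj ip T = S.
Proof.
move=> hT TS; apply: funext => x; apply: rip_ext => z.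
by rewrite rip_adjl// ripC TS ripC.
Qed.

Lemma adjK T : bounded_op ip T -> adj ip (adj ip T) = T.
Proof. by move=> hT; apply: adj_unique => [|x y]; [exact: adj_bounded|exact: rip_adjl]. Qed.

Lemma adj_id : adj ip id = id.
Proof. exact: (adj_unique bounded_op_id). Qed.

Lemma adj_comp T S : bounded_op ip T -> bounded_op ip S ->
  adj ip (T \o S) = adj ip S \o adj ip T.
Proof.
move=> hT hS; apply: adj_unique => [|x y /=]; first exact: bounded_op_comp.
by rewrite !rip_adj.
Qed.

Lemma adj_add T S : bounded_op ip T -> bounded_op ip S ->
  adj ip (T + S) = adj ip T + adj ip S.
Proof.
move=> hT hS; apply: adj_unique => [|x y /=]; first exact: bounded_op_add.
by rewrite !add_opE ripDl ripDr !rip_adj.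
Qed.

Lemma adj_rscale t T : bounded_op ip T -> adj ip (t *r T) = t *r adj ip T.
Proof.
move=> hT; apply: adj_unique => [|x y /=]; first exact: bounded_op_scale.
by rewrite !scale_opE ripZl ripZr rip_adj.
Qed.

Lemma opsumE n (F : 'I_n -> V -> V) : opsum F = \sum_(i < n) F i.
Proof. by apply: funext => v; rewrite /opsum fct_sumE. Qed.

Lemma bounded_opsum n (F : 'I_n -> V -> V) :
  (forall i, bounded_op ip (F i)) -> bounded_op ip (opsum F).
Proof.
move=> hF; rewrite opsumE; elim/big_ind: _ => // [|T S hT hS]; last exact: bounded_op_add.
rewrite -(scale0r (id : V -> V)); exact: bounded_op_scale bounded_op_id.
Qed.

(** * Operator norms and columns of operators *)

Lemma opnorm_le1 T : (forall v, rip (T v) (T v) <= rip v v) -> opnorm ip T <= 1.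
Proof.
move=> hT; apply: ge_sup; first by exists (hnorm (T 0)), 0 => //=; rewrite hnorm0.
by move=> _ [v /= v1 <-]; apply: le_trans v1; rewrite hnorm_le.
Qed.

(** Boundedness of [T] makes [opnorm] a genuine supremum; on an unbounded set [sup] is a default
    value and gives no estimate. *)
Lemma opnorm_le1P T : bounded_op ip T -> opnorm ip T <= 1 ->
  forall v, rip (T v) (T v) <= rip v v.
Proof.
move=> hT T1 v; rewrite -hnorm_le.
have [/hnorm_eq0 ->|v0] := eqVneq (hnorm v) 0; first by rewrite (bounded_op0 hT).
have vp : 0 < hnorm v by rewrite lt_def v0 hnorm_ge0.
have [c c0 hc] := bounded_op_bound hT.
have : hnorm (T ((hnorm v)^-1 *r v)) <= 1.
  apply: le_trans T1; apply: ub_le_sup.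
    exists c => _ [u /= u1 <-]; apply: le_trans (hc u) _.
    by rewrite ger_pMr.
  exists ((hnorm v)^-1 *r v) => //=.
  by rewrite hnormZ gtr0_norm ?invr_gt0// mulVf.
by rewrite (bounded_opZ _ _ hT) hnormZ gtr0_norm ?invr_gt0// ler_pdivrMl// mulr1.
Qed.

(** For v = C* C h, the square |v|^2 is the inner product of C v and C h, hence at most (|h|^2 +
    |v|^2) / 2. Taking [c i] to be an operator or its adjoint covers both sums in the theorem. *)
Lemma opnorm_column_le1 n (c d : 'I_n -> V -> V) :
  (forall i x y, rip (c i x) y = rip x (d i y)) ->
  (forall h, \sum_(i < n) rip (c i h) (c i h) <= rip h h) ->
  opnorm ip (opsum (fun i => d i \o c i)) <= 1.
Proof.
move=> cd c1; apply: opnorm_le1 => h; set v := opsum _ h.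
have : rip v v <= 2^-1 * (\sum_(i < n) rip (c i h) (c i h) + \sum_(i < n) rip (c i v) (c i v)).
  rewrite {2}/v /opsum rip_sumr -big_split mulr_sumr ler_sum// => i _ /=.
  by rewrite -cd ripC rip_amgm.
by have := c1 h; have := c1 v; lra.
Qed.

Lemma column_le n (c : 'I_n -> V -> V) :
  (forall h (k : 'I_n -> V), \sum_(i < n) rip (c i h) (k i) <=
    2^-1 * (rip h h + \sum_(i < n) rip (k i) (k i))) ->
  forall h, \sum_(i < n) rip (c i h) (c i h) <= rip h h.
Proof. by move=> h1 h; have := h1 h (fun i => c i h); lra. Qed.

(** * Estimates on the orbit of the cyclic vector *)

Section VonNeumann.
Variables (M : set (V -> V)) (xi : V).
Hypotheses (hM : von_neumann_algebra ip M) (hcyc : cyclic_vector ip M xi).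

Lemma vn_bounded T : M T -> bounded_op ip T.
Proof. by have [h _ _] := hM; exact: h. Qed.

Lemma vn_adj T : M T -> M (adj ip T).
Proof. by have [_ h _] := hM; exact: h. Qed.

Lemma vn_mem T : bounded_op ip T ->
  (forall B, commutant ip M B -> forall v, T (B v) = B (T v)) -> M T.
Proof. by move=> hT h; have [_ _ ME] := hM; rewrite ME; split. Qed.

Lemma vn_comm T B : M T -> commutant ip M B -> forall v, T (B v) = B (T v).
Proof. by move=> MT [_ h] v; rewrite h. Qed.

Lemma vn_id : M id.
Proof. exact: (vn_mem bounded_op_id). Qed.

Lemma vn_comp T S : M T -> M S -> M (T \o S).
Proof.
move=> MT MS; apply: vn_mem => [|B hB v /=].
  by apply: bounded_op_comp; exact: vn_bounded.
by rewrite (vn_comm MS hB) (vn_comm MT hB).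
Qed.

Lemma vn_add T S : M T -> M S -> M (T + S).
Proof.
move=> MT MS; apply: vn_mem => [|B hB v /=].
  by apply: bounded_op_add; exact: vn_bounded.
by rewrite !add_opE (vn_comm MS hB) (vn_comm MT hB) (bounded_opD _ _ hB.1).
Qed.

Lemma vn_scale (a : R[i]) T : M T -> M (a *: T).
Proof.
move=> MT; apply: vn_mem => [|B hB v /=].
  by apply: bounded_op_scale; exact: vn_bounded.
by rewrite !scale_opE (vn_comm MT hB) (bounded_opZ _ _ hB.1).
Qed.

Lemma vn_0 : M 0.
Proof. by rewrite -(scale0r (id : V -> V)); exact: vn_scale vn_id. Qed.

Lemma vn_real_subspace : real_subspace M.
Proof. by split; [exact: vn_0|exact: vn_add|move=> t T; exact: vn_scale]. Qed.

(** Choose [b i xi] close to [u i] by density. Expanding the sum of |u_i - b_i xi|^2 turns the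
    hypothesis into the conclusion up to that small error. *)
Lemma cyclic_column_le n (u : 'I_n -> V) (X : R) :
  (forall b : 'I_n -> V -> V, (forall i, M (b i)) ->
    \sum_(i < n) rip (u i) (b i xi) <=
    2^-1 * (X + \sum_(i < n) rip (b i xi) (b i xi))) ->
  \sum_(i < n) rip (u i) (u i) <= X.
Proof.
move=> h; apply/ler_addgt0Pr => eps eps0.
(* Dividing by n + 1 instead of n allows n = 0. *)
pose e := eps / n.+1%:R; have e0 : 0 < e by rewrite divr_gt0.
have /choice[b hb] (i : 'I_n) : exists T, M T /\ rip (u i - T xi) (u i - T xi) < e.
  have se0 : 0 < Num.sqrt e by rewrite sqrtr_gt0.
  have [T [MT hT]] := hcyc (u i) se0.
  exists T; split=> //; move: hT; rewrite hnorm_ltP ?sqrtr_gt0//.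
  by rewrite sqr_sqrtr// ltW.
have hs := h b (fun i => (hb i).1).
have : \sum_(i < n) rip (u i - b i xi) (u i - b i xi) <= eps.
  apply: (@le_trans _ _ (\sum_(i < n) e)).
    by apply: ler_sum => i _; exact: ltW (hb i).2.
  rewrite sumr_const card_ord -mulr_natr /e -mulrA ger_pMr// mulrC ler_pdivrMr//.
  by rewrite mul1r ler_nat.
have -> : \sum_(i < n) rip (u i - b i xi) (u i - b i xi) =
  \sum_(i < n) rip (u i) (u i) - 2 * (\sum_(i < n) rip (u i) (b i xi)) +
  \sum_(i < n) rip (b i xi) (b i xi).
  rewrite mulr_sumr -sumrB -big_split; apply: eq_bigr => i _ /=.
  by rewrite ripBl !ripBr (ripC (b i xi) (u i)); lra.
lra.
Qed.

Lemma cyclic_le u (X : R) :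
  (forall b, M b -> rip u (b xi) <= 2^-1 * (X + rip (b xi) (b xi))) ->
  rip u u <= X.
Proof.
move=> h; have := @cyclic_column_le 1 (fun=> u) X.
by rewrite !big_ord1; apply=> b Mb; rewrite !big_ord1; exact: h.
Qed.

Lemma cyclic_ext u v : (forall b, M b -> rip u (b xi) = rip v (b xi)) -> u = v.
Proof.
move=> h; apply/eqP; rewrite -subr_eq0; apply/eqP/rip_eq0/eqP.
rewrite eq_le rip_ge0 andbT; apply: cyclic_le => b Mb.
by rewrite ripBl h// subrr add0r; have := rip_ge0 (b xi); lra.
Qed.

(** The bound passes from the orbit to all of H by duality instead of continuity: for w = C* C h,
    testing against the orbit gives |w|^2 <= |C h|^2, while |C h|^2 is the inner product of h and
    w. *)
Lemma cyclic_column_contraction n (c d : 'I_n -> V -> V) :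
  (forall i x y, rip (c i x) y = rip x (d i y)) ->
  (forall a (b : 'I_n -> V -> V), M a -> (forall i, M (b i)) ->
    \sum_(i < n) rip (c i (a xi)) (b i xi) <=
    2^-1 * (rip (a xi) (a xi) + \sum_(i < n) rip (b i xi) (b i xi))) ->
  forall h, \sum_(i < n) rip (c i h) (c i h) <= rip h h.
Proof.
move=> cd hab h.
have ca a : M a -> \sum_(i < n) rip (c i (a xi)) (c i (a xi)) <= rip (a xi) (a xi).
  by move=> Ma; apply: cyclic_column_le => b Mb; exact: hab.
pose w := \sum_(i < n) d i (c i h).
set X := \sum_(i < n) _.
have wE v : rip v w = \sum_(i < n) rip (c i v) (c i h).
  by rewrite rip_sumr; apply: eq_bigr => i _; rewrite cd.
have wX : rip w w <= X.
  apply: cyclic_le => b Mb; rewrite ripC wE.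
  apply: (@le_trans _ _ (2^-1 * (X + \sum_(i < n) rip (c i (b xi)) (c i (b xi))))).
    rewrite -big_split mulr_sumr ler_sum// => i _ /=.
    by rewrite addrC rip_amgm.
  by have := ca b Mb; lra.
have := rip_amgm h w; rewrite wE -/X; lra.
Qed.

(** Riesz in the first variable yields vectors [w b], the values of the future adjoint on the orbit;
    Riesz in the second yields [T h] for every h, so no extension by density is needed. The
    balancing identity becomes [w (g \o b) = g (w b)], which makes [T] commute with [M]; complex
    homogeneity is the case where g is a scalar. *)
Lemma bounded_form_commutant (F : (V -> V) -> (V -> V) -> R) :
  (forall b, M b -> real_linear_on M (F^~ b)) ->
  (forall a, M a -> real_linear_on M (F a)) ->
  (forall a b, M a -> M b ->
    F a b <= 2^-1 * (rip (a xi) (a xi) + rip (b xi) (b xi))) ->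
  (forall g a b, M g -> M a -> M b -> F (g \o a) b = F a (adj ip g \o b)) ->
  exists T, commutant ip M T /\
    forall a b, M a -> M b -> rip (T (a xi)) (b xi) = F a b.
Proof.
move=> Fl Fr Fle Fmod.
have evD a b : (a + b) xi = a xi + b xi by [].
have evZ t a : (t *r a) xi = t *r a xi by [].
have /choice[w hw] (b : V -> V) : exists w, M b -> forall a, M a -> F a b = rip (a xi) w.
  have [Mb|] := pselect (M b); last by exists 0.
  have [//|||w hw] := riesz_quadratic (e := fun a : V -> V => a xi)
    (C := rip (b xi) (b xi)) vn_real_subspace _ _ (Fl b Mb).
  - by move=> t a _; exact: evZ.
  - by move=> a Ma; have := Fle a b Ma Mb; lra.
  - by exists w.
have wle b : M b -> rip (w b) (w b) <= rip (b xi) (b xi).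
  move=> Mb; apply: cyclic_le => a Ma; rewrite ripC -hw// addrC; exact: Fle.
have [M0 MD MZ] := vn_real_subspace.
have wD b b' : M b -> M b' -> w (b + b') = w b + w b'.
  move=> Mb Mb'; apply: cyclic_ext => a Ma.
  rewrite ripDl !(ripC _ (a xi)) -!hw//; last exact: MD.
  by have [-> //] := Fr a Ma.
have wZ t b : M b -> w (t *r b) = t *r w b.
  move=> Mb; apply: cyclic_ext => a Ma.
  rewrite ripZl !(ripC _ (a xi)) -!hw//; last exact: MZ.
  by have [_ ->] := Fr a Ma.
have wmod g b : M g -> M b -> w (g \o b) = g (w b).
  move=> Mg Mb; apply: cyclic_ext => a Ma.
  rewrite ripC -hw//; last exact: vn_comp.
  have gb := vn_bounded Mg; rewrite -{1}(adjK gb) -Fmod//; last exact: vn_adj.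
  rewrite hw//; last by apply: vn_comp => //; exact: vn_adj.
  by rewrite /= rip_adjl// ripC.
have /choice[T hT] (h : V) : exists u, forall b, M b -> rip h (w b) = rip (b xi) u.
  apply: (riesz_quadratic (e := fun a : V -> V => a xi) (C := rip h h) vn_real_subspace).
  - by move=> a b _ _; exact: evD.
  - by move=> t a _; exact: evZ.
  - by split=> [a b Ma Mb|t a Ma]; rewrite ?wD ?wZ// ?ripDr ?ripZr.
  - by move=> b Mb; have := wle b Mb; have := rip_amgm h (w b); lra.
have TD u v : T (u + v) = T u + T v.
  by apply: cyclic_ext => b Mb; rewrite ripDl !(ripC _ (b xi)) -!hT// ripDl.
have Tg g v : M g -> T (g v) = g (T v).
  move=> Mg; have gb := vn_bounded Mg; apply: cyclic_ext => b Mb.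
  have Mgb : M (adj ip g \o b) by apply: vn_comp => //; exact: vn_adj.
  rewrite [RHS](rip_adj _ _ gb) [RHS]ripC -[RHS](hT v _ Mgb).
  rewrite [LHS]ripC -[LHS](hT _ _ Mb) (rip_adj _ _ gb) wmod//; exact: vn_adj.
have Tle v : rip (T v) (T v) <= rip v v.
  apply: cyclic_le => b Mb; rewrite ripC -hT//.
  by have := wle b Mb; have := rip_amgm v (w b); lra.
exists T; split; last by move=> a b Ma Mb; rewrite ripC -hT// -hw.
split; last by move=> A MA v; exact: Tg.
split; last by exists 1 => v; rewrite mul1r hnorm_le.
by move=> a u v; rewrite TD -[a *: u]/((a *: (id : V -> V)) u) Tg//; exact: vn_scale vn_id.
Qed.

(** * Gauges on tuples of operators *)

Definition positive_in S :=
  [/\ M S, forall x y, rip (S x) y = rip x (S y) & forall x, 0 <= rip (S x) x].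

Lemma positive_in_add S T : positive_in S -> positive_in T -> positive_in (S + T).
Proof.
move=> [MS Ssym S0] [MT Tsym T0]; split=> [|x y|x]; first exact: vn_add.
  by rewrite !add_opE ripDl ripDr Ssym Tsym.
by rewrite add_opE ripDl addr_ge0.
Qed.

Lemma positive_in_scale t S : 0 <= t -> positive_in S -> positive_in (t *r S).
Proof.
move=> t0 [MS Ssym S0]; split=> [|x y|x]; first exact: vn_scale.
  by rewrite !scale_opE ripZl ripZr Ssym.
by rewrite scale_opE ripZl mulr_ge0.
Qed.

Lemma positive_in_id : positive_in id.
Proof. by split=> //; [exact: vn_id|exact: rip_ge0]. Qed.

Lemma positive_in_gram T : M T -> positive_in (adj ip T \o T).
Proof.
move=> MT; have hT := vn_bounded MT; split=> [|x y|x] /=.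
- by apply: vn_comp => //; exact: vn_adj.
- by rewrite rip_adjl// rip_adj.
- by rewrite rip_adjl// rip_ge0.
Qed.

Lemma positive_in_opsum n (F : 'I_n -> V -> V) :
  (forall i, positive_in (F i)) -> positive_in (opsum F).
Proof.
move=> hF; rewrite opsumE; elim/big_ind: _ => //; last exact: positive_in_add.
split=> [|x y|x]; first exact: vn_0.
  by rewrite -[(0 : V -> V) x]/(0 : V) -[(0 : V -> V) y]/(0 : V) rip0l rip0r.
by rewrite -[(0 : V -> V) x]/(0 : V) rip0l.
Qed.

(** The root and its inverse commute with all bounded operators commuting with S + eps, in
    particular with M', so they lie in M'' = M. *)
Lemma invertible_sqrt_in S (eps : R) : positive_in S -> 0 < eps ->
  exists s t : V -> V, [/\ M s /\ M t,
    (forall x y, rip (s x) y = rip x (s y)) /\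
    (forall x y, rip (t x) y = rip x (t y)),
    forall x, s (s x) = S x + eps *r x &
    (forall x, s (t x) = x) /\ (forall x, t (s x) = x)].
Proof.
move=> [MS Ssym S0] eps0.
have Me : M (S + eps *r id) by apply: vn_add => //; exact: vn_scale vn_id.
have [||s [t [[hs ht] sym sS st comm]]] :=
  @invertible_sqrt (S + eps *r id) eps (vn_bounded Me) _ eps0 _.
- by move=> x y; rewrite !add_opE !scale_opE ripDl ripDr ripZl ripZr Ssym.
- by move=> x; rewrite add_opE scale_opE ripDl ripZl lerDr.
have Mcomm B (hB : commutant ip M B) := comm B hB.1 (vn_comm Me hB).
exists s, t; split=> //; split.
  by apply: vn_mem => // B /Mcomm[].
by apply: vn_mem => // B /Mcomm[].
Qed.

Section Tuples.
Variable n : nat.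
Local Notation tuple_op := ('I_n -> V -> V).
Implicit Types (p q : tuple_op).

Definition tuples_in : set tuple_op := [set p | forall i, M (p i)].

Lemma add_tupleE p q i : (p + q) i = p i + q i. Proof. by []. Qed.

Lemma scale_tupleE t p i : (t *r p) i = t *r p i. Proof. by []. Qed.

Lemma tuples_in_subspace : real_subspace tuples_in.
Proof.
split=> [i|p q hp hq i|t p hp i]; first exact: vn_0.
  by rewrite add_tupleE; exact: vn_add.
by rewrite scale_tupleE; exact: vn_scale.
Qed.

(* The matrix inequalities saying that the column (resp. the row) with entries
   T^(-1/2) p_i S^(-1/2) is a contraction. *)
Definition column_dominated p S T := forall h (k : 'I_n -> V),
  \sum_(i < n) rip (p i h) (k i) <=
  2^-1 * (rip (S h) h + \sum_(i < n) rip (T (k i)) (k i)).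

Definition row_dominated p S T := forall (h : 'I_n -> V) k,
  \sum_(i < n) rip (p i (h i)) k <=
  2^-1 * (\sum_(i < n) rip (S (h i)) (h i) + rip (T k) k).

(** Domination is demanded at all vectors of H, as contractivity of the rescaled tuple requires,
    while the value is read at [xi] only. *)
Definition gauge_values (dom : tuple_op -> (V -> V) -> (V -> V) -> Prop) p :=
  [set c | exists S T, [/\ positive_in S, positive_in T, dom p S T &
    c = 2^-1 * (rip (S xi) xi + rip (T xi) xi)]].

Definition gauge dom p := inf (gauge_values dom p).

Lemma gauge_values_lb dom p : lbound (gauge_values dom p) 0.
Proof.
move=> _ [S [T [[_ _ S0] [_ _ T0] _ ->]]].
by have := S0 xi; have := T0 xi; lra.
Qed.

Lemma gauge_le dom p S T : positive_in S -> positive_in T -> dom p S T ->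
  gauge dom p <= 2^-1 * (rip (S xi) xi + rip (T xi) xi).
Proof.
move=> hS hT h; apply: ge_inf; last by exists S, T.
by exists 0; exact: gauge_values_lb.
Qed.

Lemma gauge_sublinear dom :
  (forall p, tuples_in p -> gauge_values dom p !=set0) ->
  (forall p q S S' T T', dom p S T -> dom q S' T' -> dom (p + q) (S + S') (T + T')) ->
  (forall t p S T, 0 < t -> dom p S T -> dom (t *r p) (t *r S) (t *r T)) ->
  sublinear_on tuples_in (gauge dom).
Proof.
move=> dom0 domD domZ; split=> [p q hp hq|t p t0 hp].
  apply: le_infD; [exact: dom0|exact: dom0|].
  move=> _ _ [S [T [hS hT h ->]]] [S' [T' [hS' hT' h' ->]]].
  apply: le_trans (gauge_le (positive_in_add hS hS') (positive_in_add hT hT')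
    (domD _ _ _ _ _ _ h h')) _.
  by rewrite !add_opE !ripDl; lra.
apply: le_infZ => //; first exact: dom0.
move=> _ [S [T [hS hT h ->]]].
apply: le_trans (gauge_le (positive_in_scale (ltW t0) hS) (positive_in_scale (ltW t0) hT)
  (domZ _ _ _ _ t0 h)) _.
by rewrite !scale_opE !ripZl; lra.
Qed.

(** Termwise AM-GM on the inner products of a_i h and b k_i. On such tuples the gauge is at most the
    bound that the operators of the decomposition must satisfy. *)
Lemma column_dominated_gram (a : tuple_op) b : (forall i, M (a i)) -> M b ->
  column_dominated (fun i => adj ip b \o a i)
    (opsum (fun i => adj ip (a i) \o a i)) (adj ip b \o b).
Proof.
move=> Ma Mb h k; rewrite /opsum rip_suml -big_split mulr_sumr.
apply: ler_sum => i _ /=; have hb := vn_bounded Mb; have ha := vn_bounded (Ma i).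
by rewrite (rip_adjl _ _ ha) !(rip_adjl _ _ hb) rip_amgm.
Qed.

Lemma row_dominated_gram a (b : tuple_op) : M a -> (forall i, M (b i)) ->
  row_dominated (fun i => adj ip (b i) \o a)
    (adj ip a \o a) (opsum (fun i => adj ip (b i) \o b i)).
Proof.
move=> Ma Mb h k; rewrite /opsum rip_suml -big_split mulr_sumr.
apply: ler_sum => i _ /=; have ha := vn_bounded Ma; have hb := vn_bounded (Mb i).
by rewrite (rip_adjl _ _ ha) !(rip_adjl _ _ hb) rip_amgm.
Qed.

Lemma column_gauge_gram (a : tuple_op) b : (forall i, M (a i)) -> M b ->
  gauge column_dominated (fun i => adj ip b \o a i) <=
  2^-1 * (\sum_(i < n) rip (a i xi) (a i xi) + rip (b xi) (b xi)).
Proof.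
move=> Ma Mb.
apply: le_trans (gauge_le _ _ (column_dominated_gram Ma Mb)) _.
- by apply: positive_in_opsum => i; exact: positive_in_gram.
- exact: positive_in_gram.
rewrite /opsum rip_suml /= (rip_adjl _ _ (vn_bounded Mb)).
by under eq_bigr => i _ do rewrite (rip_adjl _ _ (vn_bounded (Ma i))).
Qed.

Lemma row_gauge_gram a (b : tuple_op) : M a -> (forall i, M (b i)) ->
  gauge row_dominated (fun i => adj ip (b i) \o a) <=
  2^-1 * (rip (a xi) (a xi) + \sum_(i < n) rip (b i xi) (b i xi)).
Proof.
move=> Ma Mb.
apply: le_trans (gauge_le _ _ (row_dominated_gram Ma Mb)) _.
- exact: positive_in_gram.
- by apply: positive_in_opsum => i; exact: positive_in_gram.
rewrite /opsum rip_suml /= (rip_adjl _ _ (vn_bounded Ma)).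
by under eq_bigr => i _ do rewrite (rip_adjl _ _ (vn_bounded (Mb i))).
Qed.

Lemma column_gauge_values_nonempty p : tuples_in p ->
  gauge_values column_dominated p !=set0.
Proof.
move=> hp; have h := column_dominated_gram hp vn_id; rewrite adj_id in h.
exists (2^-1 * (rip (opsum (fun i => adj ip (p i) \o p i) xi) xi + rip xi xi)).
exists (opsum (fun i => adj ip (p i) \o p i)), id; split=> //; last exact: positive_in_id.
by apply: positive_in_opsum => i; exact: positive_in_gram.
Qed.

Lemma row_gauge_values_nonempty p : tuples_in p ->
  gauge_values row_dominated p !=set0.
Proof.
move=> hp; have Mp i : M (adj ip (p i)) by exact: vn_adj.
(* Read p_i as b_i* a with b_i = p_i* and a = 1. *)
have pE : (fun i => adj ip (adj ip (p i)) \o id) = p.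
  by apply: funext => i; rewrite adjK//; exact: vn_bounded.
have h := row_dominated_gram vn_id Mp; rewrite adj_id pE in h.
exists (2^-1 * (rip xi xi + rip (opsum (fun i => adj ip (adj ip (p i)) \o adj ip (p i)) xi) xi)).
exists id, (opsum (fun i => adj ip (adj ip (p i)) \o adj ip (p i))); split=> //.
+ exact: positive_in_id.
+ by apply: positive_in_opsum => i; exact: positive_in_gram.
Qed.

Lemma column_gauge_sublinear : sublinear_on tuples_in (gauge column_dominated).
Proof.
apply: gauge_sublinear => [p hp|p q S S' T T' h1 h2 h k|t p S T t0 h1 h k].
- exact: column_gauge_values_nonempty.
- have := lerD (h1 h k) (h2 h k); rewrite add_opE ripDl.
  under [in X in _ -> _ <= X]eq_bigr do rewrite add_opE ripDl.
  under [in X in _ -> X <= _]eq_bigr do rewrite add_tupleE add_opE ripDl.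
  by rewrite !big_split /=; lra.
- have := h1 h k; rewrite -(ler_pM2l t0) scale_opE ripZl.
  under [in X in _ -> _ <= X]eq_bigr do rewrite scale_opE ripZl.
  under [in X in _ -> X <= _]eq_bigr do rewrite scale_tupleE scale_opE ripZl.
  by rewrite -!mulr_sumr; lra.
Qed.

Lemma row_gauge_sublinear : sublinear_on tuples_in (gauge row_dominated).
Proof.
apply: gauge_sublinear => [p hp|p q S S' T T' h1 h2 h k|t p S T t0 h1 h k].
- exact: row_gauge_values_nonempty.
- have := lerD (h1 h k) (h2 h k); rewrite [in X in _ -> X]add_opE ripDl.
  under [in X in _ -> _ <= X]eq_bigr do rewrite add_opE ripDl.
  under [in X in _ -> X <= _]eq_bigr do rewrite add_tupleE add_opE ripDl.
  by rewrite !big_split /=; lra.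
- have := h1 h k; rewrite -(ler_pM2l t0) [in X in _ -> X]scale_opE ripZl.
  under [in X in _ -> _ <= X]eq_bigr do rewrite scale_opE ripZl.
  under [in X in _ -> X <= _]eq_bigr do rewrite scale_tupleE scale_opE ripZl.
  by rewrite -!mulr_sumr; lra.
Qed.

(** * The decomposition *)

Section Decomposition.
Variable y : 'I_n -> V -> V.
Hypothesis hy : forall i, commutant ip M (y i).
Hypothesis hnorm_y : forall x : 'I_n -> V -> V, (forall i, M (x i)) ->
  opnorm ip (opsum (fun i => x i \o y i)) <=
  Num.max (Num.sqrt (opnorm ip (opsum (fun i => adj ip (x i) \o x i))))
          (Num.sqrt (opnorm ip (opsum (fun i => x i \o adj ip (x i))))).

Definition pairing p := \sum_(i < n) rip (y i (p i xi)) xi.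

Lemma pairing_linear : real_linear_on tuples_in pairing.
Proof.
rewrite /pairing; split=> [p q _ _|t p _].
  rewrite -big_split; apply: eq_bigr => i _ /=.
  by rewrite add_tupleE add_opE (bounded_opD _ _ (hy i).1) ripDl.
rewrite mulr_sumr; apply: eq_bigr => i _ /=.
by rewrite scale_tupleE scale_opE (bounded_opZ _ _ (hy i).1) ripZl.
Qed.

(* With s = (S + S' + eps)^(1/2) and t = (T + T' + eps)^(1/2), the tuple
   z_i = t^(-1) p_i s^(-1) is both a row and a column contraction in M, and
   pairing p = <(sum_i z_i y_i) s xi, t xi>. *)
Lemma pairing_le_dominated p S T S' T' : tuples_in p ->
  positive_in S -> positive_in T -> column_dominated p S T ->
  positive_in S' -> positive_in T' -> row_dominated p S' T' ->
  pairing p <= 2^-1 * (rip (S xi) xi + rip (T xi) xi) +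
               2^-1 * (rip (S' xi) xi + rip (T' xi) xi).
Proof.
move=> hp hS hT pST hS' hT' pST'; apply/ler_addgt0Pr => e e0.
have [_ _ S0] := hS; have [_ _ T0] := hT; have [_ _ S0'] := hS'; have [_ _ T0'] := hT'.
have x0 := rip_ge0 xi.
(* The two shifts cost eps |xi|^2 in total after halving; the added 1 allows [xi = 0]. *)
pose eps := e / (rip xi xi + 1).
have eps0 : 0 < eps by rewrite divr_gt0//; lra.
have epsx : eps * rip xi xi <= e.
  by rewrite /eps mulrAC ler_pdivrMr; nra.
have [s [s' [[Ms Ms'] [ssym ssym'] sS [ss' s's]]]] :=
  invertible_sqrt_in (positive_in_add hS hS') eps0.
have [t [t' [[Mt Mt'] [tsym tsym'] tT [tt' t't]]]] :=
  invertible_sqrt_in (positive_in_add hT hT') eps0.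
have sle h : rip (S (s' h)) (s' h) + rip (S' (s' h)) (s' h) <= rip h h.
  rewrite -{5 6}[h]ss' -ssym sS add_opE !ripDl ripZl.
  by rewrite lerDl mulr_ge0 ?rip_ge0// ltW.
have tle h : rip (T (t' h)) (t' h) + rip (T' (t' h)) (t' h) <= rip h h.
  rewrite -{5 6}[h]tt' -tsym tT add_opE !ripDl ripZl.
  by rewrite lerDl mulr_ge0 ?rip_ge0// ltW.
pose z i := t' \o p i \o s'.
have Mz i : M (z i) by apply: vn_comp => //; exact: vn_comp.
have bz i : bounded_op ip (z i) by exact: vn_bounded.
(* The column bound keeps S and T and discards the positive S' and T'; the row bound does the
   reverse. *)
have zcol : opnorm ip (opsum (fun i => adj ip (z i) \o z i)) <= 1.
  apply: opnorm_column_le1 => [i u v|]; first by rewrite rip_adj.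
  apply: column_le => h k.
  apply: (@le_trans _ _ (\sum_(i < n) rip (p i (s' h)) (t' (k i)))).
    by apply: ler_sum => i _; rewrite /z /= tsym'.
  apply: le_trans (pST _ _) _.
  have h1 : \sum_(i < n) rip (T (t' (k i))) (t' (k i)) <= \sum_(i < n) rip (k i) (k i).
    by apply: ler_sum => i _; have := tle (k i); have := T0' (t' (k i)); lra.
  by have := sle h; have := S0' (s' h); lra.
have zrow : opnorm ip (opsum (fun i => z i \o adj ip (z i))) <= 1.
  apply: opnorm_column_le1 => [i u v|]; first by rewrite rip_adjl.
  apply: column_le => h k.
  apply: (@le_trans _ _ (\sum_(i < n) rip (p i (s' (k i))) (t' h))).
    by apply: ler_sum => i _; rewrite rip_adjl// ripC /z /= tsym'.
  apply: le_trans (pST' (fun i => s' (k i)) _) _.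
  have h1 : \sum_(i < n) rip (S' (s' (k i))) (s' (k i)) <= \sum_(i < n) rip (k i) (k i).
    by apply: ler_sum => i _; have := sle (k i); have := S0 (s' (k i)); lra.
  by have := tle h; have := T0 (t' h); lra.
have Z1 : opnorm ip (opsum (fun i => z i \o y i)) <= 1.
  apply: le_trans (hnorm_y Mz) _.
  by rewrite ge_max -[X in _ <= X]sqrtr1 -[X in _ && (_ <= X)]sqrtr1 !ler_wsqrtr.
have bZ : bounded_op ip (opsum (fun i => z i \o y i)).
  by apply: bounded_opsum => i; apply: bounded_op_comp => //; exact: (hy i).1.
have Zle := opnorm_le1P bZ Z1 (s xi).
(* As y_i commutes with s' and p_i, the factor s' reaches s and cancels; t' moves across the inner
   product and cancels t. *)
have -> : pairing p = rip (opsum (fun i => z i \o y i) (s xi)) (t xi).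
  rewrite /pairing /opsum rip_suml; apply: eq_bigr => i _.
  rewrite /z /= tsym' t't -(vn_comm (hp i) (hy i)).
  by rewrite (vn_comm Ms' (hy i)) s's.
have := rip_amgm (opsum (fun i => z i \o y i) (s xi)) (t xi).
have : rip (s xi) (s xi) = rip (S xi) xi + rip (S' xi) xi + eps * rip xi xi.
  by rewrite -ssym sS add_opE !ripDl ripZl.
have : rip (t xi) (t xi) = rip (T xi) xi + rip (T' xi) xi + eps * rip xi xi.
  by rewrite -tsym tT add_opE !ripDl ripZl.
by lra.
Qed.

Lemma pairing_le p : tuples_in p ->
  pairing p <= gauge column_dominated p + gauge row_dominated p.
Proof.
move=> hp; apply: le_infD.
- exact: column_gauge_values_nonempty.
- exact: row_gauge_values_nonempty.
move=> _ _ [S [T [hS hT h ->]]] [S' [T' [hS' hT' h' ->]]].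
exact: pairing_le_dominated.
Qed.

(** * Coordinates of a functional on tuples, and the final operators *)

Definition delta_tuple i T : 'I_n -> V -> V := fun j => if j == i then T else 0.

Lemma delta_tuple_in i T : M T -> tuples_in (delta_tuple i T).
Proof. by move=> MT j; rewrite /delta_tuple; case: ifP => // _; exact: vn_0. Qed.

Lemma delta_tuple_sum p : p = \sum_(i < n) delta_tuple i (p i).
Proof.
apply: funext => j; rewrite fct_sumE (bigD1 j)//= big1 /delta_tuple ?eqxx ?addr0//.
by move=> i ij; rewrite eq_sym (negbTE ij).
Qed.

Lemma delta_tuple_linear i f : real_linear_on tuples_in f ->
  real_linear_on M (fun T => f (delta_tuple i T)).
Proof.
move=> [fD fZ]; split=> [T S MT MS|t T MT].
  rewrite -fD; [|exact: delta_tuple_in..]; congr f; apply: funext => j.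
  by rewrite add_tupleE /delta_tuple; case: ifP => // _; rewrite addr0.
rewrite -fZ; last exact: delta_tuple_in; congr f; apply: funext => j.
by rewrite scale_tupleE /delta_tuple; case: ifP => // _; rewrite scaler0.
Qed.

(** The form of the i-th operator is the i-th coordinate of f at b* a. It is balanced because both
    sides of the module identity evaluate f at b* g a. Setting b_i = y_i - a_i gives b_i the form of
    [pairing - f]. *)
Lemma commutant_decomposition : exists a b : 'I_n -> V -> V,
  (forall i, [/\ commutant ip M (a i), commutant ip M (b i)
               & y i = (fun v => a i v + b i v)]) /\
  opnorm ip (opsum (fun i => a i \o adj ip (a i))) <= 1 /\
  opnorm ip (opsum (fun i => adj ip (b i) \o b i)) <= 1.
Proof.
have [f [fl fcol frow]] := linear_split tuples_in_subspace column_gauge_sublinear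
  row_gauge_sublinear pairing_linear pairing_le.
pose F i a b := f (delta_tuple i (adj ip b \o a)).
have Mab a b : M a -> M b -> M (adj ip b \o a).
  by move=> Ma Mb; apply: vn_comp => //; exact: vn_adj.
have fF (a b : 'I_n -> V -> V) : (forall i, M (a i)) -> (forall i, M (b i)) ->
    f (fun i => adj ip (b i) \o a i) = \sum_(i < n) F i (a i) (b i).
  move=> Ma Mb; rewrite [X in f X]delta_tuple_sum.
  by rewrite (real_linear_on_sum _ tuples_in_subspace fl)// => i; exact/delta_tuple_in/Mab.
have /choice[a ha] (i : 'I_n) : exists T, commutant ip M T /\
    forall a b, M a -> M b -> rip (T (a xi)) (b xi) = F i a b.
  have [fD fZ] := delta_tuple_linear i fl.
  apply: bounded_form_commutant => [b Mb|a Ma|a b Ma Mb|g a b Mg Ma Mb].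
  - have hb := adj_bounded (vn_bounded Mb); split=> [a a' Ma Ma'|t a Ma].
      rewrite /F -fD; [|exact: Mab..]; congr (f (delta_tuple i _)).
      by apply: funext => v; rewrite /= (bounded_opD _ _ hb).
    rewrite /F -fZ; last exact: Mab; congr (f (delta_tuple i _)).
    by apply: funext => v; rewrite /= (bounded_opZ _ _ hb).
  - split=> [b b' Mb Mb'|t b Mb]; have hb := vn_bounded Mb.
      by rewrite /F -fD ?adj_add//; [exact: vn_bounded|exact: Mab..].
    by rewrite /F -fZ ?adj_rscale//; exact: Mab.
  (* The bound for one index is the joint column estimate on a tuple supported at i. *)
  - pose a' := delta_tuple i a; have Ma' := delta_tuple_in i Ma.
    have := le_trans (fcol _ (fun j => Mab _ _ (Ma' j) Mb)) (column_gauge_gram Ma' Mb).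
    rewrite (fF a' (fun=> b))// (bigD1 i)//= [X in _ + X]big1; last first.
      move=> j ji; rewrite /a' /delta_tuple (negbTE ji) /F.
      have -> : adj ip b \o 0 = 0 *r (id : V -> V).
        by apply: funext => v /=; rewrite scale0r (bounded_op0 (adj_bounded (vn_bounded Mb))).
      have [_ fZj] := delta_tuple_linear j fl.
      by rewrite fZj ?mul0r//; exact: vn_id.
    rewrite [X in 2^-1 * (X + _)](bigD1 i)//= [X in _ + X + _]big1; last first.
      by move=> j ji; rewrite /a' /delta_tuple (negbTE ji) rip0l.
    by rewrite !addr0 /a' /delta_tuple eqxx.
  - have gb := vn_bounded Mg; have hb := vn_bounded Mb.
    by rewrite /F adj_comp ?adjK//; exact: adj_bounded.
have ba i : bounded_op ip (a i) := (ha i).1.1.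
exists a, (fun i => y i + (-1) *r a i).
have hb i : bounded_op ip (y i + (-1) *r a i).
  by apply: bounded_op_add; [exact: (hy i).1|exact: bounded_op_scale].
split; [move=> i; split|split].
- exact: (ha i).1.
- split=> // T MT v; rewrite !add_opE !scale_opE.
  have hT := vn_bounded MT.
  by rewrite -(vn_comm MT (hy i)) -(vn_comm MT (ha i).1) (bounded_opD _ _ hT) (bounded_opZ _ _ hT).
- by apply: funext => v; rewrite add_opE scale_opE rscaleN1 addrC subrK.
(* The column gauge bounds the sum of the inner products of a_i d_i xi and c xi. Moving a_i across
   makes this a bound for the column of adjoints, hence for the sum of the a_i a_i*. *)
- apply: opnorm_column_le1 => [i u v|]; first by rewrite rip_adjl.
  apply: cyclic_column_contraction => [i u v|c d Mc Md]; first by rewrite rip_adjl.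
  have := le_trans (fcol _ (fun i => Mab _ _ (Md i) Mc)) (column_gauge_gram Md Mc).
  rewrite (fF d (fun=> c))// [X in _ -> _ <= 2^-1 * X]addrC.
  congr (_ <= _); apply: eq_bigr => i _.
  by rewrite -(ha i).2// rip_adjl// ripC.
- apply: opnorm_column_le1 => [i u v|]; first by rewrite rip_adj.
  apply: cyclic_column_contraction => [i u v|c d Mc Md]; first by rewrite rip_adj.
  have := le_trans (frow _ (fun i => Mab _ _ Mc (Md i))) (row_gauge_gram Mc Md).
  rewrite (fF (fun=> c) d)// /pairing -sumrB.
  congr (_ <= _); apply: eq_bigr => i _.
  rewrite -(ha i).2// add_opE scale_opE ripDl ripZl mulN1r; congr (_ - _).
  by rewrite -(vn_comm (vn_adj (Md i)) (hy i)) rip_adjl//; exact: vn_bounded.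
Qed.

End Decomposition.
End Tuples.
End VonNeumann.

End Hilbert.

Unset Implicit Arguments.

Theorem theorem4 (R : realType) (V : lmodType (R[i])) (ip : V -> V -> R[i])
  (hH : hilbert_space ip) (M : set (V -> V))
  (hM : von_neumann_algebra ip M)
  (hcyc : exists xi : V, cyclic_vector ip M xi)
  (n : nat) (y : 'I_n -> V -> V)
  (hy : forall i, commutant ip M (y i))
  (hnorm_y : forall x : 'I_n -> V -> V, (forall i, M (x i)) ->
     opnorm ip (opsum (fun i => x i \o y i)) <=
     Num.max (Num.sqrt (opnorm ip (opsum (fun i => adj ip (x i) \o x i))))
             (Num.sqrt (opnorm ip (opsum (fun i => x i \o adj ip (x i)))))) :
  exists a b : 'I_n -> V -> V,
    (forall i, [/\ commutant ip M (a i), commutant ip M (b i)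
                 & y i = (fun v => a i v + b i v)]) /\
    opnorm ip (opsum (fun i => a i \o adj ip (a i))) <= 1 /\
    opnorm ip (opsum (fun i => adj ip (b i) \o b i)) <= 1.
Proof.
have [xi hxi] := hcyc.
exact: (commutant_decomposition hH hM hxi hy hnorm_y).
Qed.
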